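(* Let $K$ be a field and let $d > 0$ be an arbitrary integer. Then there exists a homogeneous ideal $I$ of the polynomial ring $S = K[x_1, \ldots, x_{3d}]$ in $3d$ variables over $K$ such that $S/I$ is a Cohen--Macaulay ring of (Krull) dimension $d$ and such that, for each integer $r$ with $0 \leq r \leq d$, there is a monomial order $<_r$ on $S$ with $\operatorname{depth}(S/\operatorname{in}_{<_r}(I)) = r$.
   Context: The polynomial ring $S = K[x_1,\ldots,x_{3d}]$ carries the standard grading, $\deg x_i = 1$ for all $i$, and ''homogeneous ideal'' refers to this grading. A monomial order on $S$ is a total order $<$ on the set of monomials of $S$ such that $1 < u$ for every monomial $u \neq 1$, and $u < v$ implies $uw < vw$ for all monomials $u, v, w$. For a nonzero $f \in S$, $\operatorname{in}_<(f)$ denotes the largest monomial with respect to $<$ among those appearing in $f$ with nonzero coefficient. The initial ideal $\operatorname{in}_<(I)$ of a nonzero ideal $I$ with respect to $<$ is the ideal of $S$ generated by all $\operatorname{in}_<(f)$ with $0 \neq f \in I$. For a homogeneous ideal $J \subsetneq S$, $\operatorname{depth}(S/J)$ is the depth of $S/J$ with respect to the graded maximal ideal $(x_1,\ldots,x_{3d})$, i.e. the common length of all maximal $S/J$-regular sequences contained in $(x_1,\ldots,x_{3d})$. *)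

(* Defs.v *)
From HB Require Import structures.
From mathcomp Require Import all_boot all_order all_algebra.
From mathcomp Require Import ring_quotient generic_quotient boolp.
From mathcomp Require Import ring.
From mathcomp.multinomials Require Import mpoly.

Set Implicit Arguments.
Unset Strict Implicit.
Unset Printing Implicit Defensive.

Import GRing.Theory.
Local Open Scope ring_scope.

(* Ideals are Prop-valued and may be improper, since initial ideals and the
   ideals generated by sequences are not given by decidable predicates; the
   library's [idealr] (decidable and proper) is kept for the ideals by which
   one forms [{ideal_quot I}]. *)
Section CommutativeAlgebra.
Variable A : comNzRingType.
Implicit Types (J P Q G : A -> Prop) (s : seq A).

Definition is_ideal J : Prop :=
  [/\ J 0, forall x y, J x -> J y -> J (x + y) & forall a x, J x -> J (a * x)].

Definition is_prime P : Prop :=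
  [/\ is_ideal P, ~ P 1 & forall x y, P (x * y) -> P x \/ P y].

Definition is_maximal P : Prop :=
  [/\ is_ideal P, ~ P 1 &
      forall J, is_ideal J -> ~ J 1 ->
        (forall x, P x -> J x) -> forall x, J x -> P x].

Definition ideal_gen G : A -> Prop := fun x =>
  exists2 c : seq (A * A), (forall p, p \in c -> G p.2)
                         & x = \sum_(p <- c) p.1 * p.2.

Definition noetherian : Prop :=
  forall J, is_ideal J ->
    exists s, forall x, J x <-> ideal_gen (fun y => y \in s) x.

Definition prime_chain (n : nat) (C : nat -> A -> Prop) : Prop :=
  (forall i, (i <= n)%N -> is_prime (C i)) /\
  (forall i, (i < n)%N ->
     (forall x, C i x -> C i.+1 x) /\ (exists x, C i.+1 x /\ ~ C i x)).

Definition has_krull_dim (n : nat) : Prop :=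
  (exists C, prime_chain n C) /\
  (forall k C, prime_chain k C -> (k <= n)%N).

(* The ideal J + (s). *)
Definition adjoin J s : A -> Prop := ideal_gen (fun x => J x \/ x \in s).

(* s is an A/J-regular sequence, A/J being regarded as an A-module: each s_i
   is a nonzerodivisor on A/(J + (s_0, ..., s_(i-1))), and A/(J + (s)) <> 0. *)
Definition regular_sequence J s : Prop :=
  (forall i b, (i < size s)%N ->
     adjoin J (take i s) (s`_i * b) -> adjoin J (take i s) b) /\
  ~ adjoin J s 1.

Definition regular_sequence_in Q J s : Prop :=
  (forall x, x \in s -> Q x) /\ regular_sequence J s.

Definition maximal_regular_sequence_in Q J s : Prop :=
  regular_sequence_in Q J s /\
  forall x, ~ regular_sequence_in Q J (rcons s x).

(* The depth of A/J with respect to the ideal Q is r. *)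
Definition has_depth Q J (r : nat) : Prop :=
  (exists s, maximal_regular_sequence_in Q J s) /\
  (forall s, maximal_regular_sequence_in Q J s -> size s = r).

Definition is_unit (x : A) : Prop := exists y, x * y = 1.

Definition nonunits : A -> Prop := fun x => ~ is_unit x.

Definition local_ring : Prop := is_ideal nonunits.

(* In a local ring the nonunits form the maximal ideal. *)
Definition cohen_macaulay_local : Prop :=
  [/\ noetherian, local_ring &
      exists r, has_krull_dim r /\ has_depth nonunits (fun x => x = 0) r].

End CommutativeAlgebra.

Arguments noetherian : clear implicits.
Arguments has_krull_dim : clear implicits.
Arguments nonunits : clear implicits.
Arguments local_ring : clear implicits.
Arguments cohen_macaulay_local : clear implicits.

(* phi : A -> B exhibits B as the localization A_P: this determines B up to a
   unique isomorphism over A, and [localization_exists] below shows that such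
   a B exists for every prime P, so that quantifying over all B is not vacuous
   in [cohen_macaulay]. *)
Definition is_localization_at (A B : comNzRingType) (P : A -> Prop)
    (phi : {rmorphism A -> B}) : Prop :=
  [/\ forall s, ~ P s -> is_unit (phi s),
      forall b, exists a s, ~ P s /\ b * phi s = phi a &
      forall a, phi a = 0 <-> exists2 s, ~ P s & s * a = 0].

Definition cohen_macaulay (A : comNzRingType) : Prop :=
  noetherian A /\
  forall M : A -> Prop, is_maximal M ->
    forall (B : comNzRingType) (phi : {rmorphism A -> B}),
      is_localization_at M phi -> cohen_macaulay_local B.

Section LocalizationExists.
Local Open Scope quotient_scope.
Variables (A : comNzRingType) (P : A -> Prop) (P_prime : is_prime P).

(* A pair (a, s) stands for the fraction a / den s. *)
Let den (s : A) : A := if `[< P s >] then 1 else s.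

Let denP s : ~ P (den s).
Proof. by rewrite /den; case: asboolP => // _; case: P_prime. Qed.

Let denE s : ~ P s -> den s = s.
Proof. by rewrite /den; case: asboolP. Qed.

Let notPM s t : ~ P s -> ~ P t -> ~ P (s * t).
Proof. by case: P_prime => _ _ h ? ? /h[]. Qed.

Let notP1 : ~ P 1. Proof. by case: P_prime. Qed.

Let eqf (x y : A * A) : bool :=
  `[< exists2 u, ~ P u & u * (x.1 * den y.2 - y.1 * den x.2) = 0 >].

Let eqf_refl : reflexive eqf.
Proof. by move=> x; apply/asboolP; exists 1 => //; rewrite subrr mulr0. Qed.

Let eqf_sym : ssrbool.symmetric eqf.
Proof.
have h x y : eqf x y -> eqf y x.
  move=> /asboolP[u Pu e]; apply/asboolP; exists u => //.
  by rewrite -opprB mulrN e oppr0.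
by move=> x y; apply/idP/idP; apply: h.
Qed.

Let eqf_trans : transitive eqf.
Proof.
move=> y x z /asboolP[u Pu e] /asboolP[v Pv f]; apply/asboolP.
exists (u * v * den y.2); first by do 2 apply: notPM => //.
transitivity (v * den z.2 * (u * (x.1 * den y.2 - y.1 * den x.2)) +
              u * den x.2 * (v * (y.1 * den z.2 - z.1 * den y.2))); first ring.
by rewrite e f !mulr0 addr0.
Qed.

Let eqf_equiv := EquivRel eqf eqf_refl eqf_sym eqf_trans.

Let L := {eq_quot eqf_equiv}.

Let fr (a s : A) : L := \pi_L (a, s).

Let frP a s b t : (exists2 u, ~ P u & u * (a * den t - b * den s) = 0) <->
  fr a s = fr b t.
Proof.
split=> [h|/eqmodP /asboolP //].
by apply/eqmodP; apply/asboolP.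
Qed.

Let frE (x : L) : exists a s, ~ P s /\ x = fr a s.
Proof.
rewrite -[x]reprK; case: (repr x) => a s; exists a, (den s); split=> //.
by apply/frP; exists 1 => //; rewrite /= (denE (@denP s)) subrr mulr0.
Qed.

Let ladd (x y : L) : L :=
  let: (a, s) := repr x in let: (b, t) := repr y in
  fr (a * den t + b * den s) (den s * den t).
Let lmul (x y : L) : L :=
  let: (a, s) := repr x in let: (b, t) := repr y in
  fr (a * b) (den s * den t).
Let lopp (x : L) : L := let: (a, s) := repr x in fr (- a) s.

Let frr a s : exists a' s', repr (fr a s) = (a', s') /\
  exists2 u, ~ P u & u * (a' * den s - a * den s') = 0.
Proof.
case e : (repr (fr a s)) => [a' s']; exists a', s'; split=> //; apply/frP.
by rewrite /fr -e reprK.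
Qed.

Let denM s t : den (den s * den t) = den s * den t.
Proof. by apply/denE/notPM. Qed.

Let laddE a s b t : ~ P s -> ~ P t ->
  ladd (fr a s) (fr b t) = fr (a * t + b * s) (s * t).
Proof.
move=> Ps Pt; rewrite /ladd.
have [a' [s' [-> [u Pu e]]]] := frr a s.
have [b' [t' [-> [v Pv f]]]] := frr b t.
apply/frP; exists (u * v); first exact: notPM.
rewrite denM (denE (notPM Ps Pt)); move: e f; rewrite (denE Ps) (denE Pt).
move=> e f; transitivity (v * (t * den t') * (u * (a' * s - a * den s')) +
  u * (s * den s') * (v * (b' * t - b * den t'))); first ring.
by rewrite e f !mulr0 addr0.
Qed.

Let lmulE a s b t : ~ P s -> ~ P t ->
  lmul (fr a s) (fr b t) = fr (a * b) (s * t).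
Proof.
move=> Ps Pt; rewrite /lmul.
have [a' [s' [-> [u Pu e]]]] := frr a s.
have [b' [t' [-> [v Pv f]]]] := frr b t.
apply/frP; exists (u * v); first exact: notPM.
rewrite denM (denE (notPM Ps Pt)); move: e f; rewrite (denE Ps) (denE Pt).
move=> e f; transitivity (v * (t * b') * (u * (a' * s - a * den s')) +
  u * (a * den s') * (v * (b' * t - b * den t'))); first ring.
by rewrite e f !mulr0 addr0.
Qed.

Let loppE a s : ~ P s -> lopp (fr a s) = fr (- a) s.
Proof.
move=> Ps; rewrite /lopp.
have [a' [s' [-> [u Pu e]]]] := frr a s.
apply/frP; exists u => //.
by rewrite -[RHS]oppr0 -e; ring.
Qed.

Let frQ a s b t : ~ P s -> ~ P t -> a * t = b * s -> fr a s = fr b t.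
Proof.
move=> Ps Pt e; apply/frP; exists 1 => //.
by rewrite !denE // e subrr mulr0.
Qed.

Local Ltac lsolve :=
  rewrite ?(laddE, lmulE, loppE) //; repeat apply: notPM => //;
  try (apply: frQ; [by repeat apply: notPM | by repeat apply: notPM | ring]).

Let laddA : associative ladd.
Proof.
move=> x y z; have [a [s [Ps ->]]] := frE x; have [b [t [Pt ->]]] := frE y.
by have [c [w [Pw ->]]] := frE z; lsolve.
Qed.

Let laddC : commutative ladd.
Proof.
by move=> x y; have [a [s [Ps ->]]] := frE x; have [b [t [Pt ->]]] := frE y;
  lsolve.
Qed.

Let ladd0 : left_id (fr 0 1) ladd.
Proof. by move=> x; have [a [s [Ps ->]]] := frE x; lsolve. Qed.

Let laddN : left_inverse (fr 0 1) lopp ladd.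
Proof. by move=> x; have [a [s [Ps ->]]] := frE x; lsolve. Qed.

Let lmulA : associative lmul.
Proof.
move=> x y z; have [a [s [Ps ->]]] := frE x; have [b [t [Pt ->]]] := frE y.
by have [c [w [Pw ->]]] := frE z; lsolve.
Qed.

Let lmulC : commutative lmul.
Proof.
by move=> x y; have [a [s [Ps ->]]] := frE x; have [b [t [Pt ->]]] := frE y;
  lsolve.
Qed.

Let lmul1 : left_id (fr 1 1) lmul.
Proof. by move=> x; have [a [s [Ps ->]]] := frE x; lsolve. Qed.

Let lmulD : left_distributive lmul ladd.
Proof.
move=> x y z; have [a [s [Ps ->]]] := frE x; have [b [t [Pt ->]]] := frE y.
by have [c [w [Pw ->]]] := frE z; lsolve.
Qed.

Let l1_neq0 : fr 1 1 != fr 0 1.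
Proof.
apply/eqP => /frP[u Pu]; rewrite denE // mul0r subr0 !mulr1 => u0.
by apply: Pu; rewrite u0; case: P_prime => -[].
Qed.

Lemma localization_exists :
  exists (B : comNzRingType) (phi : {rmorphism A -> B}),
    is_localization_at P phi.
Proof.
pose C : choiceType := {eq_quot eqf_equiv}.
pose Z : zmodType :=
  HB.pack C (GRing.isZmodule.Build C laddA laddC ladd0 laddN).
pose B : comNzRingType :=
  HB.pack Z (GRing.Zmodule_isComNzRing.Build Z lmulA lmulC lmul1 lmulD l1_neq0).
pose loc (a : A) : B := fr a 1.
have locB : zmod_morphism loc.
  move=> a b; change (fr (a - b) 1 = ladd (fr a 1) (lopp (fr b 1))); by lsolve.
have locM : monoid_morphism loc.
  split=> // a b; change (fr (a * b) 1 = lmul (fr a 1) (fr b 1)); by lsolve.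
pose phi : {rmorphism A -> B} := HB.pack loc
  (GRing.isZmodMorphism.Build A B loc locB)
  (GRing.isMonoidMorphism.Build A B loc locM).
exists B, phi; split=> [s Ps|b|a].
- exists (fr 1 s); change (lmul (fr s 1) (fr 1 s) = fr 1 1); by lsolve.
- have [a [s [Ps ->]]] := frE b; exists a, s; split=> //.
  by change (lmul (fr a s) (fr s 1) = fr a 1); lsolve.
- change (fr a 1 = fr 0 1 <-> exists2 s, ~ P s & s * a = 0).
  split=> [/frP[u Pu]|[u Pu e]].
    by rewrite denE // mul0r subr0 mulr1; exists u.
  by apply/frP; exists u => //; rewrite denE // mul0r subr0 mulr1.
Qed.

End LocalizationExists.

Section InitialIdeals.
Variables (K : fieldType) (n : nat).
Local Notation S := {mpoly K[n]}.

Definition homogeneous_ideal (I : idealr S) : Prop :=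
  forall (f : S) (k : nat), f \in I -> pihomog mdeg k f \in I.

(* A monomial is identified with its exponent vector, so 0%MM is the monomial
   1 and +%MM is the product of monomials; lt is the strict order. *)
Definition monomial_order (lt : rel 'X_{1..n}) : Prop :=
  [/\ irreflexive lt, transitive lt,
      forall u v, u != v -> lt u v || lt v u,
      forall u, u != 0%MM -> lt 0%MM u &
      forall u v w, lt u v -> lt (u + w)%MM (v + w)%MM].

Definition is_initial_monomial (lt : rel 'X_{1..n}) (f : S)
    (m : 'X_{1..n}) : Prop :=
  m \in msupp f /\ forall u, u \in msupp f -> u != m -> lt u m.

Definition initial_ideal (lt : rel 'X_{1..n}) (I : idealr S) : S -> Prop :=
  ideal_gen (fun g => exists f m,
    [/\ f \in I, f != 0, is_initial_monomial lt f m & g = 'X_[m]]).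

Definition graded_maximal_ideal : S -> Prop :=
  ideal_gen (fun g => exists i : 'I_n, g = 'X_i).

End InitialIdeals.

Arguments graded_maximal_ideal : clear implicits.

(* Main.v *)
From HB Require Import structures.
Require Import Defs.
From mathcomp Require Import all_boot all_order all_algebra.
From mathcomp Require Import ring_quotient generic_quotient boolp.
From mathcomp Require Import ring zify.
From mathcomp.multinomials Require Import ssrcomplements mpoly.

(** For [d = 1] the ideal is [I = (x^2, x y, y^2 - x z)], the kernel of the map
    from [K[x, y, z]] to [K[s, t] / (t^3)] sending [x], [y], [z] to [s t^2], [s t],
    [s].  The quotient is free over [K[z]] with basis [1], [y], [x].  If
    [y^2 > x z], the initial ideal is [(x^2, x y, y^2)], modulo which [z] is
    regular, and the depth is 1.  If [x z > y^2], the initial ideal is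
    [(x^2, x y, x z, y^3)], every variable kills the nonzero class of [x], and the
    depth is 0.  In general [I] is the sum of [d] copies of this ideal in disjoint
    blocks of variables, that is, the kernel of the map to
    [K[s_j, t_j] / (t_j^3)], and the order prefers [y_j^2] in [r] blocks and
    [x_j z_j] in the other ones.  The [z_j] of those [r] blocks form a regular
    sequence modulo the initial ideal, after which the product of all [x_j] is
    killed by every variable ([initial_idealE], [initial_ideal_depth]).  One
    maximal regular sequence determines the depth, because all of them have the
    same length ([has_depthI]).

    For the Cohen-Macaulay property let [P = K[z_1, .., z_d]].  The quotient [S / I]
    is a finite free [P]-module, and it retracts onto [P] with nilpotent kernel.  A
    prime of [S] over [I] contracts to a prime of [P].  For such a prime there are
    [h] elements of it that become a regular sequence after localization and
    [d - h] elements that are algebraically independent modulo it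
    ([prime_parameters_mpoly], by induction on the number of variables).  By
    freeness the [h] elements stay regular in the localization of [S / I].
    Conversely, any [d + 1] elements of [P] are algebraically dependent
    ([algebraic_dependence]), and a relation can be divided and reduced along a
    regular sequence or a chain of primes until it involves only the [d - h]
    independent elements ([dependence_descent]); so regular sequences and prime
    chains have length at most [h].  Finally, a regular sequence of length [h] in a
    prime produces a chain of primes of length [h] ([regular_prime_chain]).  Hence
    [h] is both the dimension and the depth of the localization
    ([localization_cohen_macaulay]). *)

Set Implicit Arguments.
Unset Strict Implicit.
Unset Printing Implicit Defensive.

Import Order.TTheory GRing.Theory.
Local Open Scope ring_scope.

(** * Ideals and regular sequences *)

Section Ideals.
Variable A : comNzRingType.
Implicit Types (J P Q G : A -> Prop) (s t : seq A).

Lemma ideal_ext J1 J2 : (forall x, J1 x <-> J2 x) -> J1 = J2.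
Proof. by move=> h; apply/funext=> x; apply/propext. Qed.

Lemma ideal0 J : is_ideal J -> J 0. Proof. by case. Qed.
Lemma idealD J x y : is_ideal J -> J x -> J y -> J (x + y).
Proof. by case=> _ h _; apply: h. Qed.
Lemma idealM J a x : is_ideal J -> J x -> J (a * x).
Proof. by case=> _ _ h; apply: h. Qed.
Lemma idealMl J a x : is_ideal J -> J x -> J (x * a).
Proof. by move=> iJ Jx; rewrite mulrC; apply: idealM. Qed.
Lemma idealN J x : is_ideal J -> J x -> J (- x).
Proof. by move=> iJ Jx; rewrite -mulN1r; apply: idealM. Qed.
Lemma idealB J x y : is_ideal J -> J x -> J y -> J (x - y).
Proof. by move=> iJ Jx Jy; apply: idealD => //; apply: idealN. Qed.

Lemma ideal_sum J (I : Type) (r : seq I) (p : pred I) (F : I -> A) :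
  is_ideal J -> (forall i, p i -> J (F i)) -> J (\sum_(i <- r | p i) F i).
Proof.
by move=> iJ h; apply: big_ind => //; [apply: ideal0 | move=> ? ?; apply: idealD].
Qed.

Lemma prime_idealX J x n : is_prime J -> J (x ^+ n) -> J x.
Proof.
case=> iJ J1 Jp; elim: n => [|n IH]; first by rewrite expr0.
by rewrite exprS => /Jp[].
Qed.

Lemma prime_ideal J : is_prime J -> is_ideal J. Proof. by case. Qed.

Lemma ideal_gen_ideal G : is_ideal (ideal_gen G).
Proof.
split; first by exists [::]; rewrite ?big_nil.
  move=> _ _ [c Gc ->] [c' Gc' ->]; exists (c ++ c'); last by rewrite big_cat.
  by move=> p; rewrite mem_cat => /orP[/Gc|/Gc'].
move=> a _ [c Gc ->]; exists [seq (a * p.1, p.2) | p <- c].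
  by move=> ? /mapP[p pc ->] /=; apply: (Gc p).
by rewrite big_map mulr_sumr; apply: eq_bigr => p _; rewrite mulrA.
Qed.

Lemma ideal_gen_sub G x : G x -> ideal_gen G x.
Proof.
move=> Gx; exists [:: (1, x)]; last by rewrite big_seq1 mul1r.
by move=> p; rewrite inE => /eqP->.
Qed.

Lemma ideal_gen_min G J : is_ideal J -> (forall x, G x -> J x) ->
  forall x, ideal_gen G x -> J x.
Proof.
move=> iJ GJ _ [c Gc ->]; rewrite big_seq; apply: ideal_sum => // p pc.
by apply: idealM => //; apply: GJ; apply: Gc.
Qed.

Lemma ideal_gen_mono G G' : (forall x, G x -> G' x) ->
  forall x, ideal_gen G x -> ideal_gen G' x.
Proof.
move=> h; apply: ideal_gen_min; first exact: ideal_gen_ideal.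
by move=> x /h; apply: ideal_gen_sub.
Qed.

Lemma adjoin_ideal J s : is_ideal (adjoin J s). Proof. exact: ideal_gen_ideal. Qed.

Lemma adjoin_subl J s x : J x -> adjoin J s x.
Proof. by move=> Jx; apply: ideal_gen_sub; left. Qed.

Lemma adjoin_subr J s x : x \in s -> adjoin J s x.
Proof. by move=> xs; apply: ideal_gen_sub; right. Qed.

Lemma adjoin_min J s Q : is_ideal Q -> (forall x, J x -> Q x) ->
  (forall x, x \in s -> Q x) -> forall x, adjoin J s x -> Q x.
Proof. by move=> iQ JQ sQ; apply: ideal_gen_min => // x []; [apply: JQ|apply: sQ]. Qed.

Lemma adjoin_nil J : is_ideal J -> adjoin J [::] = J.
Proof.
move=> iJ; apply: ideal_ext => x; split; last exact: adjoin_subl.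
exact: adjoin_min.
Qed.

Lemma adjoin_cat J s t : adjoin J (s ++ t) = adjoin (adjoin J s) t.
Proof.
apply: ideal_ext => x; split; apply: adjoin_min; try exact: adjoin_ideal.
- by move=> y Jy; do 2 apply: adjoin_subl.
- move=> y; rewrite mem_cat => /orP[ys|]; last exact: adjoin_subr.
  by apply: adjoin_subl; apply: adjoin_subr.
- apply: adjoin_min; first exact: adjoin_ideal.
    by move=> y; apply: adjoin_subl.
  by move=> y ys; apply: adjoin_subr; rewrite mem_cat ys.
- by move=> y yt; apply: adjoin_subr; rewrite mem_cat yt orbT.
Qed.

Lemma adjoin_cons J x s : adjoin J (x :: s) = adjoin (adjoin J [:: x]) s.
Proof. by rewrite -cat1s adjoin_cat. Qed.

Lemma adjoin_rcons J s x : adjoin J (rcons s x) = adjoin (adjoin J s) [:: x].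
Proof. by rewrite -cats1 adjoin_cat. Qed.

Lemma adjoinC J s t : adjoin (adjoin J s) t = adjoin (adjoin J t) s.
Proof.
rewrite -!adjoin_cat; congr ideal_gen; apply: ideal_ext => x.
by rewrite !mem_cat orbC.
Qed.

Lemma adjoin1P J x y : is_ideal J ->
  adjoin J [:: x] y <-> exists a, J (y - a * x).
Proof.
move=> iJ; split; last first.
  move=> [a h]; rewrite -[y](subrK (a * x)); apply: idealD.
  - exact: adjoin_ideal.
  - exact: adjoin_subl.
  - by apply: idealM; [exact: adjoin_ideal | apply: adjoin_subr; rewrite inE].
move: y; apply: ideal_gen_min.
  split.
  - by exists 0; rewrite mul0r subrr; apply: ideal0.
  - move=> u v [a ha] [b hb]; exists (a + b).
    by rewrite mulrDl opprD addrACA; apply: idealD.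
  - by move=> a u [b hb]; exists (a * b); rewrite -mulrA -mulrBr; apply: idealM.
move=> y [Jy|]; first by exists 0; rewrite mul0r subr0.
by rewrite inE => /eqP ->; exists 1; rewrite mul1r subrr; apply: ideal0.
Qed.

(** The relative notion [N J x] is either that of a nonzerodivisor modulo [J]
    or its analogue after localization; the recursive form lets ideals
    vary along an induction on the sequence. *)
Fixpoint regular_by (N : (A -> Prop) -> A -> Prop) J s : Prop :=
  if s is x :: s' then N J x /\ regular_by N (adjoin J [:: x]) s' else True.

Lemma regular_by_cat N J s t : is_ideal J ->
  regular_by N J (s ++ t) <->
  regular_by N J s /\ regular_by N (adjoin J s) t.
Proof.
elim: s J => [|x s IH] J iJ /=; first by rewrite adjoin_nil; tauto.
rewrite (adjoin_cons J x s).
by have := IH _ (adjoin_ideal J [:: x]); tauto.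
Qed.

Lemma regular_by_rcons N J s x : is_ideal J ->
  regular_by N J (rcons s x) <-> regular_by N J s /\ N (adjoin J s) x.
Proof. by move=> iJ; rewrite -cats1 regular_by_cat //=; tauto. Qed.

Definition nonzerodivisor J x := forall b, J (x * b) -> J b.

Lemma regular_sequenceP J s : is_ideal J ->
  regular_sequence J s <-> regular_by nonzerodivisor J s /\ ~ adjoin J s 1.
Proof.
move=> iJ; rewrite /regular_sequence.
suff : (forall i b, (i < size s)%N ->
     adjoin J (take i s) (s`_i * b) -> adjoin J (take i s) b) <->
     regular_by nonzerodivisor J s by tauto.
elim: s J iJ => [|x s IH] J iJ //=; rewrite -IH; last exact: adjoin_ideal.
split=> [h|[h1 h2]].
  split=> [b|i b lt_is]; first by have := h 0 b isT; rewrite /= adjoin_nil.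
  by have := h i.+1 b lt_is; rewrite /= adjoin_cons.
move=> [|i] b; rewrite /= ?ltnS => lt_is; first by rewrite adjoin_nil //; apply: h1.
by rewrite adjoin_cons; apply: h2.
Qed.

End Ideals.

Arguments nonzerodivisor {A}.

Definition zero_ideal (A : comNzRingType) : A -> Prop := fun x => x = 0.

Lemma zero_ideal_ideal (A : comNzRingType) : is_ideal (@zero_ideal A).
Proof.
by split=> // [x y -> ->|a x ->]; rewrite /zero_ideal ?addr0 ?mulr0.
Qed.

Lemma prime_prod (A : comNzRingType) (P : A -> Prop) (I : Type) (r : seq I)
    (F : I -> A) :
  is_prime P -> (forall i, ~ P (F i)) -> ~ P (\prod_(i <- r) F i).
Proof.
move=> [_ nP1 PM] nPF; elim/big_ind: _ => // x y nPx nPy /PM[] //.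
Qed.

Lemma preim_prime (A B : comNzRingType) (g : {rmorphism A -> B}) (P : B -> Prop) :
  is_prime P -> is_prime (fun x => P (g x)).
Proof.
case=> iP nP1 PM; split; last by move=> x y; rewrite rmorphM; apply: PM.
  split=> [|x y|a x]; rewrite ?rmorph0 ?rmorphD ?rmorphM.
  - exact: ideal0.
  - exact: idealD.
  - exact: idealM.
by rewrite rmorph1.
Qed.

Lemma maximal_prime (A : comNzRingType) (M : A -> Prop) : is_maximal M -> is_prime M.
Proof.
move=> [iM nM1 maxM]; split=> // x y Mxy; have [|nMx] := pselect (M x); first by left.
right; have : adjoin M [:: x] 1.
  apply: contrapT => n1; apply: nMx.
  apply: (maxM _ (adjoin_ideal M [:: x]) n1); last by apply: adjoin_subr; rewrite inE.
  by move=> z; apply: adjoin_subl.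
move=> /(adjoin1P _ _ iM)[a ha].
have -> : y = y * (1 - a * x) + a * (x * y) by ring.
by apply: idealD => //; apply: idealM.
Qed.

Definition radical (A : comNzRingType) (J : A -> Prop) : A -> Prop :=
  fun x => exists n, J (x ^+ n).

Lemma radical_ideal (A : comNzRingType) (J : A -> Prop) :
  is_ideal J -> is_ideal (radical J).
Proof.
move=> iJ; split; first by exists 1%N; rewrite expr1; apply: ideal0.
  move=> x y [m Jx] [n Jy]; exists (m + n)%N; rewrite exprDn.
  apply: ideal_sum => // i _; rewrite -mulr_natl; apply: idealM => //.
  have [le_n|lt_n] := leqP n i.
    by rewrite -[in y ^+ _](subnK le_n) exprD mulrA; apply: idealM.
  have le_m : (m <= m + n - i)%N by lia.
  by rewrite -[in x ^+ _](subnK le_m) exprD mulrAC; apply: idealM.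
by move=> a x [n Jx]; exists n; rewrite exprMn; apply: idealM.
Qed.

Lemma ideal_congrD (A : comNzRingType) (J : A -> Prop) x x' y y' :
  is_ideal J -> J (x - x') -> J (y - y') -> J (x + y - (x' + y')).
Proof. by move=> iJ Jx Jy; rewrite opprD addrACA; apply: idealD. Qed.

Lemma ideal_congrM (A : comNzRingType) (J : A -> Prop) x x' y y' :
  is_ideal J -> J (x - x') -> J (y - y') -> J (x * y - x' * y').
Proof.
move=> iJ Jx Jy.
have -> : x * y - x' * y' = y * (x - x') + x' * (y - y') by ring.
by apply: idealD => //; apply: idealM.
Qed.

(** Used for the passage to polynomial rings, to isomorphic rings and to
    localizations; [E] is each time the extension of ideals. *)
Lemma regular_by_map (A B : comNzRingType) (g : A -> B)
    (E : (A -> Prop) -> B -> Prop)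
    (N : (A -> Prop) -> A -> Prop) (N' : (B -> Prop) -> B -> Prop) :
  (forall J, is_ideal J -> is_ideal (E J)) ->
  (forall J x, is_ideal J -> E (adjoin J [:: x]) = adjoin (E J) [:: g x]) ->
  (forall J x, is_ideal J -> N J x -> N' (E J) (g x)) ->
  forall J s, is_ideal J -> regular_by N J s ->
    regular_by N' (E J) (map g s) /\ E (adjoin J s) = adjoin (E J) (map g s).
Proof.
move=> iE hE hN J s; elim: s J => [|x s IH] J iJ /=.
  by move=> _; split=> //; rewrite !adjoin_nil //; apply: iE.
move=> [Nx rs]; rewrite (adjoin_cons J x s) (adjoin_cons (E J) (g x) (map g s)) -hE //.
have [r' e'] := IH _ (adjoin_ideal J [:: x]) rs.
by split=> //; split=> //; apply: hN.
Qed.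

(** * Noetherian rings *)

Section Noetherian.
Variables (A : comNzRingType) (noethA : noetherian A).
Implicit Types (J P Q G : A -> Prop) (s t : seq A).

(** Stronger than [noetherian]: the finitely many generators are found in the given
    generating set. *)
Lemma noetherian_gen G : exists s, (forall x, x \in s -> G x) /\
  forall x, ideal_gen G x -> ideal_gen (fun y => y \in s) x.
Proof.
have [s0 hs0] := noethA (ideal_gen_ideal G).
have [s [sG hs]] : exists s, (forall x, x \in s -> G x) /\
    forall x, x \in s0 -> ideal_gen (fun y => y \in s) x.
  have: forall x, x \in s0 -> ideal_gen G x.
    by move=> x xs; apply/hs0; apply: ideal_gen_sub.
  elim: (s0) => [|x s1 IH] h; first by exists [::].
  have [s [sG hs]] := IH (fun y ys => h y (mem_behead (s := x :: s1) ys)).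
  have [c cG ex] := h x (mem_head _ _).
  exists (map snd c ++ s); split=> y; rewrite ?mem_cat ?inE.
    by move=> /orP[/mapP[p pc ->]|]; [apply: cG | apply: sG].
  move=> /orP[/eqP->|/hs]; last first.
    by apply: ideal_gen_mono => z zs; rewrite mem_cat zs orbT.
  exists c => // p pc; rewrite mem_cat; apply/orP; left.
  by apply/mapP; exists p.
exists s; split=> // x /hs0; apply: ideal_gen_min => //.
exact: ideal_gen_ideal.
Qed.

Lemma noetherian_max (F : (A -> Prop) -> Prop) J0 :
  (forall J, F J -> is_ideal J) -> F J0 ->
  exists J, [/\ F J, forall x, J0 x -> J x &
    forall J', F J' -> (forall x, J x -> J' x) -> forall x, J' x -> J x].
Proof.
move=> Fid FJ0; apply: contrapT => /forallNP noJ.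
pose T := {J | F J /\ forall x, J0 x -> J x}.
have next (C : T) : exists C' : T, (forall x, sval C x -> sval C' x) /\
    exists x, sval C' x /\ ~ sval C x.
  case: C => J /= [FJ J0J].
  apply: contrapT => /forallNP h; apply: (noJ J); split=> // J' FJ' JJ' x J'x.
  apply: contrapT => nJx.
  have J0J' y : J0 y -> J' y by move=> /J0J /JJ'.
  apply: (h (exist (fun J => F J /\ forall x, J0 x -> J x) J' (conj FJ' J0J'))).
  by split=> //=; exists x.
have [f hf] := choice next.
pose C n : T := iter n f (exist (fun J => F J /\ forall x, J0 x -> J x) J0
  (conj FJ0 (fun _ h => h))).
have Cmono m n x : (m <= n)%N -> sval (C m) x -> sval (C n) x.
  move=> /subnKC <-; elim: (n - m)%N => [|k IH]; rewrite ?addn0 // addnS.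
  by move=> /IH; apply: (hf _).1.
have Cid n : is_ideal (sval (C n)) by apply: Fid; case: (svalP (C n)).
have [s [sG hs]] := noetherian_gen (fun x => exists n, sval (C n) x).
have [n hn] : exists n, forall x, x \in s -> sval (C n) x.
  elim: (s) (sG) => [|y s' IH] h; first by exists 0%N.
  have [n hn] := IH (fun z zs => h z (mem_behead (s := y :: s') zs)).
  have [m hm] := h y (mem_head _ _).
  exists (maxn n m) => z; rewrite inE => /orP[/eqP ->|/hn].
    by apply: Cmono hm; apply: leq_maxr.
  by apply: Cmono; apply: leq_maxl.
have [x [Cx nCx]] := (hf (C n)).2.
apply: nCx; apply: (ideal_gen_min (Cid n) hn); apply: hs.
by apply: ideal_gen_sub; exists n.+1.
Qed.

End Noetherian.

(** * The common length of maximal regular sequences *)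

Section Depth.
Variables (A : comNzRingType) (noethA : noetherian A).
Implicit Types (J P Q G : A -> Prop) (s t : seq A).

Lemma prime_not_contains_inter P n (R : nat -> A -> Prop) : is_prime P ->
  (forall i, (i < n)%N -> is_ideal (R i) /\ exists x, R i x /\ ~ P x) ->
  exists x, ~ P x /\ forall i, (i < n)%N -> R i x.
Proof.
move=> pP; elim: n => [|n IH] h; first by exists 1; split=> //; case: pP.
have [|x [nPx Rx]] := IH; first by move=> i lt_in; apply: h; apply: ltnW.
have [iR [y [Ry nPy]]] := h n (ltnSn n).
exists (x * y); split; first by case: pP => _ _ pP /pP[].
move=> i; rewrite ltnS leq_eqVlt => /orP[/eqP->|lt_in]; first exact: idealM.
by apply: idealMl; [case: (h i (ltnW lt_in)) | apply: Rx].
Qed.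

(** An element lying in [P n] but in no earlier [P i] is corrected by an element
    of [Q] outside [P n] that lies in every earlier [P i] not contained in
    [P n]; those contained in [P n] are avoided together with [P n]. *)
Lemma prime_avoidance Q n (P : nat -> A -> Prop) : is_ideal Q ->
  (forall i, (i < n)%N -> is_prime (P i) /\ exists x, Q x /\ ~ P i x) ->
  exists x, Q x /\ forall i, (i < n)%N -> ~ P i x.
Proof.
move=> iQ; elim: n => [|n IH] h; first by exists 0; split=> //; apply: ideal0.
have [|x [Qx nPx]] := IH; first by move=> i lt_in; apply: h; apply: ltnW.
have [pPn [q [Qq nPq]]] := h n (ltnSn n).
have [Pnx|nPnx] := pselect (P n x); last first.
  exists x; split=> // i; rewrite ltnS leq_eqVlt => /orP[/eqP->|] //.
  exact: nPx.
pose R i := if (i == n) || `[< forall y, P i y -> P n y >] then Q else P i.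
have [|y [nPy Ry]] := @prime_not_contains_inter (P n) n.+1 R pPn.
  move=> i lt_in; rewrite /R; case: eqP => [_|ne_in] /=.
    by split=> //; exists q.
  case: asboolP => [sub|nsub]; first by split=> //; exists q.
  split; first by case: (h i lt_in) => -[].
  apply: contrapT => /forallNP hn; apply: nsub => y Py.
  by apply: contrapT => nPy; apply: (hn y).
exists (x + y); split.
  by apply: idealD => //; have := Ry n (ltnSn n); rewrite /R eqxx.
have nPxy : ~ P n (x + y).
  move=> Pxy; apply: nPy; rewrite -[y](addKr x) addrC.
  by apply: idealB => //; case: pPn.
move=> i; rewrite ltnS leq_eqVlt => /orP[/eqP->|] // lt_in.
have := Ry i (ltnW lt_in); rewrite /R ltn_eqF //=.
case: asboolP => [sub _ /sub|_ Piy Pixy] //.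
apply: (nPx _ lt_in); rewrite -[x](addrK y); apply: idealB => //.
by case: (h i (ltnW lt_in)) => -[].
Qed.

(** The primes are the maximal annihilators modulo [J]: the elements having such
    an annihilator generate an ideal that is generated by finitely many of them,
    and by primality the annihilators of these already are all of them. *)
Lemma zero_divisors_union_primes J : is_ideal J ->
  exists n (P : nat -> A -> Prop),
    (forall i, (i < n)%N -> exists2 u, ~ J u & forall x, P i x -> J (x * u)) /\
    (forall i, (i < n)%N -> is_prime (P i)) /\
    forall x, (forall i, (i < n)%N -> ~ P i x) -> nonzerodivisor J x.
Proof.
move=> iJ; pose ann u : A -> Prop := fun x => J (x * u).
have iann u : is_ideal (ann u).
  split; rewrite /ann; first by rewrite mul0r; apply: ideal0.
    by move=> x y; rewrite mulrDl; apply: idealD.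
  by move=> a x; rewrite -mulrA; apply: idealM.
pose U u := ~ J u /\ forall v, ~ J v -> (forall x, ann u x -> ann v x) ->
  forall x, ann v x -> ann u x.
have pann u : U u -> is_prime (ann u).
  move=> [nJu maxu]; split=> //; first by rewrite /ann mul1r.
  move=> x y xyu; have [yu|nyu] := pselect (ann u y); [by right | left].
  apply: (maxu (y * u)) => //; last by rewrite /ann mulrA.
  by move=> z zu; rewrite /ann mulrCA; apply: idealM.
have [s [sU hs]] := noetherian_gen noethA U.
exists (size s), (fun i => ann s`_i); split; last split.
- by move=> i lt_is; exists s`_i => //; apply: (sU _ (mem_nth 0 lt_is)).1.
- by move=> i lt_is; apply: pann; apply: sU; apply: mem_nth.
move=> x nx b Jxb; apply: contrapT => nJb.
have [||_ [[u nJu ->] bu maxu]] := @noetherian_max _ noethA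
  (fun R => exists2 u, ~ J u & R = ann u) (ann b).
- by move=> _ [u _ ->].
- by exists b.
have Uu : U u.
  by split=> // v nJv uv; apply: maxu => //; exists v.
have [i lt_is siu] : exists2 i, (i < size s)%N & forall y, ann s`_i y -> ann u y.
  apply: contrapT => hn.
  have [|y [nuy hy]] := @prime_not_contains_inter (ann u) (size s)
    (fun i => ann s`_i) (pann u Uu).
    move=> i lt_is; split=> //; apply: contrapT => /forallNP h; apply: hn.
    by exists i => // y yi; apply: contrapT => nyu; apply: (h y).
  apply: nuy; rewrite /ann.
  have : ideal_gen (fun z => z \in s) u by apply: hs; apply: ideal_gen_sub.
  case=> c cs ->; rewrite mulr_sumr big_seq; apply: ideal_sum => // p pc.
  rewrite mulrCA; apply: idealM => //; have ps := cs p pc.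
  by rewrite -(nth_index 0 ps); apply: hy; rewrite index_mem.
apply: (nx i lt_is); apply: (sU _ (mem_nth 0 lt_is)).2 (bu x Jxb) => //.
Qed.

Lemma common_nonzerodivisor Q m (F : nat -> A -> Prop) : is_ideal Q ->
  (forall k, (k < m)%N -> is_ideal (F k) /\
     exists x, Q x /\ nonzerodivisor (F k) x) ->
  exists x, Q x /\ forall k, (k < m)%N -> nonzerodivisor (F k) x.
Proof.
move=> iQ h.
have [n [P [hP nzP]]] : exists n (P : nat -> A -> Prop),
    (forall i, (i < n)%N -> is_prime (P i) /\ exists x, Q x /\ ~ P i x) /\
    forall x, (forall i, (i < n)%N -> ~ P i x) ->
      forall k, (k < m)%N -> nonzerodivisor (F k) x.
  elim: m h => [|m IH] h; first by exists 0%N, (fun _ _ => True).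
  have [|n [P [hP nzP]]] := IH; first by move=> k lt_km; apply: h; apply: ltnW.
  have [iF [x [Qx nzx]]] := h m (ltnSn m).
  have [n' [P' [annP' [pP' nzP']]]] := zero_divisors_union_primes iF.
  exists (n + n')%N, (fun i => if (i < n)%N then P i else P' (i - n)%N); split.
    move=> i lt_i; case: ltnP => [/hP //|le_ni].
    have lt_i' : (i - n < n')%N by rewrite ltn_subLR.
    split; first exact: pP'.
    have [u nFu P'u] := annP' _ lt_i'.
    by exists x; split=> // /P'u /nzx.
  move=> y hy k; rewrite ltnS leq_eqVlt => /orP[/eqP->|].
    apply: nzP' => i lt_in'; have := hy (n + i)%N; rewrite ltn_add2l => /(_ lt_in').
    by rewrite ltnNge leq_addr /= addKn.
  by apply: nzP => i lt_in; have := hy i (ltn_addr _ lt_in); rewrite lt_in.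
have [x [Qx nPx]] := prime_avoidance iQ hP.
by exists x; split=> //; apply: nzP.
Qed.

Definition has_socle Q J := exists u, ~ J u /\ forall q, Q q -> J (q * u).

Lemma socle_no_nonzerodivisor Q J x : has_socle Q J -> Q x ->
  ~ nonzerodivisor J x.
Proof. by move=> [u [nJu Qu]] /Qu Jxu /(_ u Jxu). Qed.

(** By prime avoidance [Q] lies in one of the primes of zero divisors, which is an
    annihilator. *)
Lemma no_nonzerodivisor_socle Q J : is_ideal Q -> is_ideal J ->
  (forall x, Q x -> ~ nonzerodivisor J x) -> has_socle Q J.
Proof.
move=> iQ iJ noQ; apply: contrapT => nosoc.
have [n [P [annP [pP nzP]]]] := zero_divisors_union_primes iJ.
have [|x [Qx nPx]] := @prime_avoidance Q n P iQ; last exact: (noQ x Qx (nzP x nPx)).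
move=> i lt_in; split; first exact: pP.
apply: contrapT => /forallNP h; apply: nosoc.
have [u nJu Pu] := annP i lt_in; exists u; split=> // q Qq; apply: Pu.
by apply: contrapT => nPq; apply: (h q).
Qed.

(** For [u] in the socle modulo [x], write [y * u = x * v] modulo [J]; then [v] is in
    the socle modulo [y]. *)
Lemma socle_exchange Q J x y : is_ideal J -> Q x -> Q y ->
  nonzerodivisor J x -> nonzerodivisor J y ->
  has_socle Q (adjoin J [:: x]) -> has_socle Q (adjoin J [:: y]).
Proof.
move=> iJ Qx Qy nx ny [u [nu Qu]].
have [v hv] := (adjoin1P x (y * u) iJ).1 (Qu y Qy).
exists v; split.
  move=> /(adjoin1P _ _ iJ)[w hw]; apply: nu; apply/(adjoin1P _ _ iJ).
  exists w; apply: ny.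
  have -> : y * (u - w * x) = (y * u - v * x) + x * (v - w * y) by ring.
  by apply: idealD => //; apply: idealM.
move=> q Qq; have [e he] := (adjoin1P x (q * u) iJ).1 (Qu q Qq).
apply/(adjoin1P _ _ iJ); exists e; apply: nx.
have -> : x * (q * v - e * y) = y * (q * u - e * x) - q * (y * u - v * x) by ring.
by apply: idealB => //; apply: idealM.
Qed.

(** If [x * b = z * c] modulo [J], then regularity of [z] modulo [J + (x)] makes [c]
    a multiple of [x] modulo [J], and [x] cancels: so [x] is regular modulo
    [J + (z)]. *)
Lemma regular_move_front J s z : is_ideal J ->
  (forall i, (i <= size s)%N -> nonzerodivisor (adjoin J (take i s)) z) ->
  regular_by nonzerodivisor J s ->
  regular_by nonzerodivisor (adjoin J [:: z]) s.
Proof.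
elim: s J => [|x s IH] J iJ //= nz [nx rs]; split; last first.
  rewrite adjoinC; apply: IH => //; first exact: adjoin_ideal.
  by move=> i lt_is; have := nz i.+1 lt_is; rewrite /= adjoin_cons.
have nzJ : nonzerodivisor J z by have := nz 0%N isT; rewrite /= adjoin_nil.
have nzx : nonzerodivisor (adjoin J [:: x]) z.
  by have := nz 1%N isT; rewrite /= take0.
move=> b /(adjoin1P _ _ iJ)[c hc].
have /nzx /(adjoin1P _ _ iJ)[e he] : adjoin J [:: x] (z * c).
  apply/(adjoin1P _ _ iJ); exists b.
  by rewrite -opprB; apply: idealN => //; rewrite mulrC [z * c]mulrC.
apply/(adjoin1P _ _ iJ); exists e; apply: nx.
have -> : x * (b - e * z) = (x * b - c * z) + z * (c - e * x) by ring.
by apply: idealD => //; apply: idealM.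
Qed.

Lemma regular_take J s i : is_ideal J -> (i < size s)%N ->
  regular_by nonzerodivisor J s -> nonzerodivisor (adjoin J (take i s)) s`_i.
Proof.
move=> iJ lt_is; rewrite -{1}(cat_take_drop i s) regular_by_cat // => -[_].
by rewrite (drop_nth 0) //= => -[].
Qed.

(** Both sequences are altered in their last element, by [socle_exchange], to a
    common one; moved to the front, it reduces their lengths. *)
Lemma socle_regular_invariant Q s t J : is_ideal Q -> is_ideal J ->
  size s = size t -> (forall x, x \in s -> Q x) -> (forall x, x \in t -> Q x) ->
  regular_by nonzerodivisor J s -> regular_by nonzerodivisor J t ->
  has_socle Q (adjoin J s) -> has_socle Q (adjoin J t).
Proof.
move=> iQ; elim/last_ind: s t J => [|s x IH] t J iJ.
  by move/esym/size0nil->.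
elim/last_ind: t => [|t y _]; first by rewrite size_rcons.
rewrite !size_rcons => -[sz] sQ tQ rs rt.
have Qx : Q x by apply: sQ; rewrite mem_rcons mem_head.
have Qy : Q y by apply: tQ; rewrite mem_rcons mem_head.
have {}sQ z : z \in s -> Q z by move=> zs; apply: sQ; rewrite mem_rcons inE zs orbT.
have {}tQ z : z \in t -> Q z by move=> zt; apply: tQ; rewrite mem_rcons inE zt orbT.
have hnext u w i : (forall z, z \in u -> Q z) -> Q w -> (i <= size u)%N ->
    regular_by nonzerodivisor J (rcons u w) ->
    exists z, Q z /\ nonzerodivisor (adjoin J (take i u)) z.
  move=> uQ Qw le_iu ru; exists (rcons u w)`_i; split.
    by rewrite nth_rcons; case: ltngtP le_iu => // lt_iu _; apply/uQ/mem_nth.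
  have -> : take i u = take i (rcons u w).
    rewrite -cats1 take_cat; case: ltngtP le_iu => // -> _.
    by rewrite subnn take_size cats0.
  by apply: regular_take; rewrite ?size_rcons ?ltnS.
pose F k := if (k <= size s)%N then adjoin J (take k s)
            else adjoin J (take (k - (size s).+1) t).
have [|z [Qz nz]] := @common_nonzerodivisor Q ((size s).+1 + (size t).+1) F iQ.
  move=> k lt_k; rewrite /F; case: leqP => [le_ks|lt_sk].
    by split; [apply: adjoin_ideal | apply: hnext rs].
  split; first exact: adjoin_ideal.
  by apply: hnext rt => //; rewrite leq_subLR -ltnS -addnS.
have nzs i : (i <= size s)%N -> nonzerodivisor (adjoin J (take i s)) z.
  by move=> le_is; have := nz i; rewrite /F le_is; apply; lia.
have nzt i : (i <= size t)%N -> nonzerodivisor (adjoin J (take i t)) z.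
  move=> le_it; have := nz ((size s).+1 + i)%N; rewrite /F.
  have -> : ((size s).+1 + i <= size s)%N = false by lia.
  by rewrite addKn; apply; rewrite ltn_add2l ltnS.
move: rs rt; rewrite !regular_by_rcons // !adjoin_rcons.
move=> [rs nx] [rt ny] socx.
have iJs := adjoin_ideal J s; have iJt := adjoin_ideal J t.
have nzs' : nonzerodivisor (adjoin J s) z by have := nzs _ (leqnn _); rewrite take_size.
have nzt' : nonzerodivisor (adjoin J t) z by have := nzt _ (leqnn _); rewrite take_size.
apply: (socle_exchange iJt Qz Qy nzt' ny).
rewrite adjoinC; apply: (IH t (adjoin J [:: z])) => //; first exact: adjoin_ideal.
- exact: regular_move_front.
- exact: regular_move_front.
by rewrite adjoinC; apply: (socle_exchange iJs Qx Qz nx nzs').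
Qed.

Lemma adjoin_proper Q J s : is_ideal Q -> ~ Q 1 -> (forall x, J x -> Q x) ->
  (forall x, x \in s -> Q x) -> ~ adjoin J s 1.
Proof. by move=> iQ nQ1 JQ sQ /(adjoin_min iQ JQ sQ). Qed.

Lemma regular_sequence_inP Q J s : is_ideal Q -> ~ Q 1 -> is_ideal J ->
  (forall x, J x -> Q x) ->
  regular_sequence_in Q J s <->
  (forall x, x \in s -> Q x) /\ regular_by nonzerodivisor J s.
Proof.
move=> iQ nQ1 iJ JQ; rewrite /regular_sequence_in regular_sequenceP //.
by split=> [[sQ []]|[sQ rs]] //; do 2 split=> //; apply: adjoin_proper sQ.
Qed.

(** All maximal regular sequences in [Q] have the same length, because by
    [socle_regular_invariant] the existence of a socle after dividing out a
    regular sequence depends on its length only. *)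
Lemma has_depthI Q J s : is_ideal Q -> ~ Q 1 -> is_ideal J ->
  (forall x, J x -> Q x) -> (forall x, x \in s -> Q x) ->
  regular_by nonzerodivisor J s ->
  (forall x, Q x -> ~ nonzerodivisor (adjoin J s) x) ->
  has_depth Q J (size s).
Proof.
move=> iQ nQ1 iJ JQ sQ rs maxs.
have regP := regular_sequence_inP _ iQ nQ1 iJ JQ.
split.
  exists s; split; first exact/regP.
  move=> x /regP[sxQ]; rewrite regular_by_rcons // => -[_ nx].
  by apply: maxs nx; apply: sxQ; rewrite mem_rcons mem_head.
have socle_cut u v : (forall x, x \in u -> Q x) -> (forall x, x \in v -> Q x) ->
    regular_by nonzerodivisor J u -> regular_by nonzerodivisor J v ->
    has_socle Q (adjoin J u) -> (size v <= size u)%N.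
  move=> uQ vQ ru rv socu; rewrite leqNgt; apply/negP => lt_uv.
  have sz : size u = size (take (size u) v) by rewrite size_takel // ltnW.
  have tQ x : x \in take (size u) v -> Q x by move=> /mem_take/vQ.
  have rt : regular_by nonzerodivisor J (take (size u) v).
    by move: rv; rewrite -{1}(cat_take_drop (size u) v) regular_by_cat // => -[].
  have := socle_regular_invariant iQ iJ sz uQ tQ ru rt socu.
  move=> /socle_no_nonzerodivisor /(_ (vQ _ (mem_nth 0 lt_uv))); apply.
  exact: regular_take.
have socI u : (forall x, Q x -> ~ nonzerodivisor (adjoin J u) x) ->
    has_socle Q (adjoin J u).
  by apply: no_nonzerodivisor_socle => //; apply: adjoin_ideal.
move=> t [/regP[tQ rt] maxt]; apply/eqP; rewrite eqn_leq; apply/andP; split.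
  by apply: socle_cut (socI _ maxs).
apply: socle_cut (socI _ _) => // x Qx nx; apply: (maxt x); apply/regP.
rewrite regular_by_rcons //; split=> // y; rewrite mem_rcons inE.
by move=> /orP[/eqP->|/tQ].
Qed.

End Depth.

(** * Chains of primes from regular sequences *)

Section Chains.
Variables (A : comNzRingType) (noethA : noetherian A).
Implicit Types (J P Q : A -> Prop) (s t : seq A).

Lemma nonzerodivisorX J x n b : nonzerodivisor J x -> J (x ^+ n * b) -> J b.
Proof.
move=> nx; elim: n => [|n IH]; first by rewrite expr0 mul1r.
by rewrite exprS -mulrA => /nx.
Qed.

(** An ideal maximal among those disjoint from the multiplicative set of the
    [a ^+ k * s] with [s] outside [Q] is prime. *)
Lemma prime_below J Q a : is_prime Q -> is_ideal J -> (forall x, J x -> Q x) ->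
  nonzerodivisor J a ->
  exists P, [/\ is_prime P, forall x, J x -> P x, forall x, P x -> Q x & ~ P a].
Proof.
move=> pQ iJ JQ na; have [iQ nQ1 QM] := pQ.
pose F (R : A -> Prop) := is_ideal R /\ forall k x, ~ Q x -> ~ R (a ^+ k * x).
have [||P [[iP disj] JP maxP]] := @noetherian_max _ noethA F J.
- by move=> R [].
- by split=> // k x nQx /(nonzerodivisorX na)/JQ.
have outP x : ~ P x -> exists k (y c : A), ~ Q y /\ P (a ^+ k * y - c * x).
  move=> nPx; apply: contrapT => h; apply: nPx.
  apply: (maxP (adjoin P [:: x])); last by apply: adjoin_subr; rewrite inE.
    split=> [|k y nQy /(adjoin1P _ _ iP)[c hc]]; first exact: adjoin_ideal.
    by apply: h; exists k, y, c.
  by move=> y; apply: adjoin_subl.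
exists P; split=> //; last by have := disj 1%N 1 nQ1; rewrite expr1 mulr1.
  split=> //; first by have := disj 0%N 1 nQ1; rewrite expr0 mulr1.
  move=> x y Pxy; have [|nPx] := pselect (P x); first by left.
  right; apply: contrapT => /outP[l [v [e [nQv hy]]]].
  have [k [u [c [nQu hx]]]] := outP x nPx.
  apply: (disj (k + l)%N (u * v)); first by move=> /QM[].
  have -> : a ^+ (k + l) * (u * v) =
    a ^+ l * v * (a ^+ k * u - c * x) + c * x * (a ^+ l * v - e * y)
    + c * e * (x * y) by rewrite exprD; ring.
  by do 2?[apply: idealD => //]; apply: idealM.
move=> x Px; apply: contrapT => nQx.
by apply: (disj 0%N x nQx); rewrite expr0 mul1r.
Qed.

(** The chain is built downwards from [Q]: a prime containing a partial ideal of the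
    sequence, and avoiding the next element, lies below each prime already found. *)
Lemma regular_prime_chain J Q s : is_prime Q -> is_ideal J ->
  (forall x, J x -> Q x) -> (forall x, x \in s -> Q x) ->
  regular_by nonzerodivisor J s -> exists C : nat -> A -> Prop, prime_chain (size s) C.
Proof.
move=> pQ iJ JQ sQ rs.
suff [C [chC _]] : exists C : nat -> A -> Prop,
    prime_chain (size s) C /\ C (size s) = Q by exists C.
elim/last_ind: s Q pQ JQ sQ rs => [|s x IH] Q pQ JQ sQ rs.
  by exists (fun _ => Q); split=> //; split.
move: rs; rewrite regular_by_rcons // size_rcons => -[rs nx].
have Qx : Q x by apply: sQ; rewrite mem_rcons mem_head.
have [|P [pP JP PQ nPx]] := prime_below pQ (adjoin_ideal J s) _ nx.
  apply: adjoin_min => //; first by case: pQ.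
  by move=> y ys; apply: sQ; rewrite mem_rcons inE ys orbT.
have [|y ys|C [[pC incC] CP]] := IH P pP _ _ rs.
- by move=> y Jy; apply: JP; apply: adjoin_subl.
- by apply: JP; apply: adjoin_subr.
exists (fun i => if (i <= size s)%N then C i else Q); rewrite ltnn; split=> //.
split=> i; first by case: ifP => // /pC.
rewrite ltnS => le_is; have [->|lt_is] : i = size s \/ (i < size s)%N by lia.
  by rewrite leqnn ltnn CP; split=> //; exists x.
by rewrite (ltnW lt_is) lt_is; apply: incC.
Qed.

End Chains.

(** * Polynomial relations along regular sequences *)

Section BoxEval.

(** The value at [l] of the polynomial with coefficients [c e], for the exponent
    vectors [e] with all entries below [N]; the recursion singles out the first
    variable. *)
Fixpoint box_eval (K C : comNzRingType) (kappa : K -> C) (N : nat) (l : seq C)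
    (c : seq nat -> K) : C :=
  if l is a :: l' then
    \sum_(i < N) a ^+ i * box_eval kappa N l' (fun e => c ((i : nat) :: e))
  else kappa (c [::]).

Definition box_nonzero (K : comNzRingType) (N k : nat) (c : seq nat -> K) :=
  exists e : seq nat, [/\ size e = k, all (fun i => i < N)%N e & c e <> 0].

Lemma box_eval_morph (K C D : comNzRingType) (kappa : K -> C)
    (g : {rmorphism C -> D}) N l c :
  box_eval (g \o kappa) N (map g l) c = g (box_eval kappa N l c).
Proof.
elim: l c => [|a l IH] c //=; rewrite rmorph_sum; apply: eq_bigr => i _.
by rewrite rmorphM rmorphXn IH.
Qed.

Variables (K C : comNzRingType) (kappa : {rmorphism K -> C}).

Lemma box_eval0 N l c : ~ box_nonzero N (size l) c -> box_eval kappa N l c = 0.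
Proof.
elim: l c => [|a l IH] c h /=.
  have [->|c0] := pselect (c [::] = 0); first exact: rmorph0.
  by case: h; exists [::].
rewrite big1 // => i _; rewrite IH ?mulr0 // => -[e [sz lt_e ce]].
by apply: h; exists ((i : nat) :: e); rewrite /= sz ltn_ord.
Qed.

(** A relation between the [a] and the [tau] is divided by the largest power of
    the first element of [a]; the quotient holds modulo [J 0], and setting that
    element to zero gives a relation modulo [J 1] between the others. *)
Lemma dependence_descent (J : nat -> C -> Prop) (a tau : seq C) N c n :
  (forall i, (i <= size a)%N -> is_ideal (J i)) ->
  (forall i, (i < size a)%N ->
     [/\ forall x, J i x -> J i.+1 x, J i.+1 a`_i & nonzerodivisor (J i) a`_i]) ->
  box_nonzero N (size a + size tau) c ->
  J 0%N (box_eval kappa N (a ++ tau) c ^+ n) ->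
  exists c' m, box_nonzero N (size tau) c' /\
    J (size a) (box_eval kappa N tau c' ^+ m).
Proof.
elim: a J c n => [|a l IH] J c n iJ hJ c0 h; first by exists c, n.
have [J01 J1a na] := hJ 0%N isT.
have iJ0 := iJ 0%N isT; have iJ1 := iJ 1%N isT.
have ex_i : exists i, `[< (i < N)%N /\
    box_nonzero N (size l + size tau) (fun e => c (i :: e)) >].
  have [[|i e] [sz lt_e ce]] // := c0.
  case: sz lt_e => sz /andP[lt_iN lt_e].
  by exists i; apply/asboolP; split=> //; exists e.
(* The lowest power of [a] in the relation is [i]; [w j] is its coefficient of
   [a ^+ j]. *)
case: (ex_minnP ex_i) => i /asboolP[lt_iN c_i0] min_i.
pose w j := box_eval kappa N (l ++ tau) (fun e => c (j :: e)).
have w0 j : (j < i)%N -> w j = 0.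
  move=> lt_ji; apply: box_eval0; rewrite size_cat => cj.
  have : (i <= j)%N.
    by apply: min_i; apply/asboolP; split=> //; apply: ltn_trans lt_iN.
  by rewrite leqNgt lt_ji.
have [r er] : exists r, box_eval kappa N (a :: l ++ tau) c = a ^+ i * (w i + a * r).
  exists (\sum_(j < N | (i < j)%N) a ^+ (j - i.+1) * w j) => /=.
  rewrite (bigID (fun j : 'I_N => (i < j)%N)) /= addrC mulrDr; congr (_ + _).
    rewrite (bigD1 (Ordinal lt_iN)) /= ?ltnn // big1 ?addr0 // => j.
    rewrite -leqNgt leq_eqVlt -(inj_eq val_inj) /=.
    by case: eqP => //= _; rewrite andbT => /w0; rewrite /w => ->; rewrite mulr0.
  rewrite !mulr_sumr; apply: eq_bigr => j lt_ij.
  by rewrite !mulrA -exprSr -exprD subnKC.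
have J1w : J 1%N (w i ^+ n).
  have : J 1%N ((w i + a * r) ^+ n).
    apply: J01; apply: (nonzerodivisorX (n := i * n) na).
    by move: h; rewrite cat_cons er exprMn -exprM.
  move=> h1; rewrite -[X in J 1%N X](subKr ((w i + a * r) ^+ n)).
  apply: idealB => //; rewrite subrXX; apply: idealMl => //.
  by rewrite addrC addKr mulrC; apply: idealM.
apply: (IH (fun k => J k.+1) (fun e => c (i :: e)) n) => //.
  by move=> k; apply: (iJ k.+1).
by move=> k; apply: (hJ k.+1).
Qed.

End BoxEval.

(** * Hilbert's basis theorem *)

Section HilbertBasis.

(** Covers quotients and localizations at once. *)
Lemma noetherian_fractions (A B : comNzRingType) (phi : {rmorphism A -> B}) :
  noetherian A ->
  (forall b, exists a s, is_unit (phi s) /\ b * phi s = phi a) -> noetherian B.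
Proof.
move=> noethA frac J iJ.
have [|s hs] := noethA (fun a => J (phi a)).
  split; first by rewrite rmorph0; apply: ideal0.
    by move=> x y; rewrite rmorphD; apply: idealD.
  by move=> a x; rewrite rmorphM; apply: idealM.
have sJ y : y \in s -> J (phi y) by move=> ys; apply/hs/ideal_gen_sub.
exists (map phi s) => x; split; last first.
  by apply: ideal_gen_min => // _ /mapP[y ys ->]; apply: sJ.
have [a [t [[u tu] xt]]] := frac x => Jx.
have : ideal_gen (fun y => y \in s) a by apply/hs; rewrite -xt; apply: idealMl.
case=> c cs ea; rewrite -[x]mulr1 -tu mulrA xt ea rmorph_sum.
apply: idealMl; first exact: ideal_gen_ideal.
rewrite big_seq; apply: ideal_sum; first exact: ideal_gen_ideal.
move=> p pc; rewrite rmorphM; apply: idealM; first exact: ideal_gen_ideal.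
by apply: ideal_gen_sub; apply: map_f; apply: cs.
Qed.

Lemma noetherian_field (K : fieldType) : noetherian K.
Proof.
move=> J iJ; have [J1|nJ1] := pselect (J 1).
  exists [:: 1] => x; split=> _; last by rewrite -[x]mulr1; apply: idealM.
  by exists [:: (x, 1)]; rewrite ?big_seq1 ?mulr1 // => p; rewrite !inE => /eqP->.
exists [::] => x; split; last by apply: ideal_gen_min.
move=> Jx; have [->|x0] := eqVneq x 0; first exact: ideal0 (ideal_gen_ideal _).
by case: nJ1; rewrite -(mulVf x0); apply: idealM.
Qed.

Variables (R : comNzRingType) (noethR : noetherian R).

(** The leading coefficients in an ideal are generated by those of finitely many
    elements, of degree at most [N]; below degree [N] the leading coefficients are
    treated degree by degree. *)
Theorem noetherian_poly : noetherian {poly R}.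
Proof.
move=> J iJ.
pose lead (L : {poly R} -> Prop) n (c : R) :=
  exists f, [/\ L f, (size f <= n.+1)%N & f`_n = c].
have ilead L n : is_ideal L -> is_ideal (lead L n).
  move=> iL; split.
  - by exists 0; rewrite size_poly0 coef0; split=> //; apply: ideal0.
  - move=> _ _ [f [Lf sf <-]] [g [Lg sg <-]]; exists (f + g); rewrite coefD.
    split=> //; first exact: idealD.
    by rewrite (leq_trans (size_polyD _ _)) // geq_max sf.
  - move=> a _ [f [Lf sf <-]]; exists (a%:P * f); rewrite coefCM; split=> //.
      exact: idealM.
    by rewrite mul_polyC (leq_trans (size_scale_leq _ _)).
have lead_sub L L' n c : (forall f, L f -> L' f) -> lead L n c -> lead L' n c.
  by move=> sub [f [Lf sf <-]]; exists f; split=> //; apply: sub.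
have size_shift m n (f : {poly R}) : (m <= n)%N -> (size f <= m.+1)%N ->
    (size (('X^(n - m) * f)%R : {poly R}) <= n.+1)%N.
  move=> le_mn sf; apply: leq_trans (size_polyMleq _ _) _.
  by rewrite size_polyXn addSn /=; move: (size f) sf => k; lia.
have coef_shift m n (f : {poly R}) : (m <= n)%N -> ('X^(n - m) * f)`_n = f`_m.
  by move=> le_mn; rewrite coefXnM ltnNge leq_subr /= subKn.
have lead_mono m n c : (m <= n)%N -> lead J m c -> lead J n c.
  move=> le_mn [f [Jf sf <-]]; exists ('X^(n - m) * f); split.
  - exact: idealM.
  - exact: size_shift.
  - exact: coef_shift.
(* [lead J n] increases with [n], so it is stationary. *)
have [s [sG hs]] := noetherian_gen noethR (fun c => exists n, lead J n c).
have [N hN] : exists N, forall n c, lead J n c -> lead J N c.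
  have [N sN] : exists N, forall c, c \in s -> lead J N c.
    elim: (s) (sG) => [|y s' IH] h; first by exists 0%N.
    have [n hn] := IH (fun z zs => h z (mem_behead (s := y :: s') zs)).
    have [m hm] := h y (mem_head _ _).
    exists (maxn n m) => z; rewrite inE => /orP[/eqP ->|/hn].
      by apply: lead_mono hm; apply: leq_maxr.
    by apply: lead_mono; apply: leq_maxl.
  exists N => n c cn; apply: (ideal_gen_min (ilead J N iJ) sN); apply: hs.
  by apply: ideal_gen_sub; exists n.
pose gen (F : seq {poly R}) := ideal_gen (fun f => f \in F).
have igen F : is_ideal (gen F) by apply: ideal_gen_ideal.
have gen_sub F F' : {subset F <= F'} -> forall f, gen F f -> gen F' f.
  by move=> sub; apply: ideal_gen_mono.
have [F [FJ hF]] : exists F, (forall f, f \in F -> J f) /\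
    forall n c, (n < N.+1)%N -> lead J n c -> lead (gen F) n c.
  elim: N.+1 => [|M [F [FJ hF]]]; first by exists [::].
  have [t ht] := noethR (ilead J M iJ).
  have [F' [F'J hF']] : exists F', (forall f, f \in F' -> J f) /\
      forall c, c \in t -> lead (gen F') M c.
    have : forall c, c \in t -> lead J M c by move=> c ct; apply/ht/ideal_gen_sub.
    elim: (t) => [|c t' IH] h; first by exists [::].
    have [F' [F'J hF']] := IH (fun z zs => h z (mem_behead (s := c :: t') zs)).
    have [f [Jf sf fM]] := h c (mem_head _ _).
    exists (f :: F'); split=> [g|c']; rewrite inE => /orP[/eqP->|] //.
    - exact: F'J.
    - by exists f; split=> //; apply: ideal_gen_sub; rewrite mem_head.
    - move=> /hF'; apply: lead_sub; apply: gen_sub => z zF'.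
      by rewrite inE zF' orbT.
  exists (F ++ F'); split=> [f|n c]; first by rewrite mem_cat => /orP[/FJ|/F'J].
  rewrite ltnS leq_eqVlt => /orP[/eqP->|lt_nM]; last first.
    move=> /(hF n c lt_nM); apply: lead_sub; apply: gen_sub => z zF.
    by rewrite mem_cat zF.
  move=> /ht; move: c; apply: ideal_gen_min; first exact: ilead.
  move=> c /hF'; apply: lead_sub; apply: gen_sub => z zF'.
  by rewrite mem_cat zF' orbT.
exists F => f; split; last exact: ideal_gen_min.
have [n] := ubnP (size f); elim: n f => // n IH f; rewrite ltnS => sf Jf.
have [g [gF sg gn]] : exists g, [/\ gen F g, (size g <= n)%N & g`_n.-1 = f`_n.-1].
  case: n sf {IH} => [|n] sf /=.
    exists 0; rewrite size_poly0 coef0; split=> //; first exact: ideal0.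
    by move: sf; rewrite leqn0 size_poly_eq0 => /eqP->; rewrite coef0.
  have fn : lead J n f`_n by exists f.
  case: (leqP n N) => [le_nN|lt_Nn]; first by apply: hF.
  have [g [gF sg gN]] := hF N _ (ltnSn N) (hN _ _ fn).
  exists ('X^(n - N) * g); split; first exact: idealM.
    exact: size_shift (ltnW lt_Nn) sg.
  by rewrite coef_shift // ltnW.
rewrite -[f](subrK g); apply: (idealD (igen F)) => //.
case: n sf sg gn IH => [|n] sf sg gn IH.
  have /eqP-> : f == 0 by rewrite -size_poly_eq0 -leqn0.
  have /eqP-> : g == 0 by rewrite -size_poly_eq0 -leqn0.
  by rewrite subr0; apply: ideal0.
apply: IH; last by apply: idealB => //; apply: ideal_gen_min gF.
rewrite ltnS; apply/leq_sizeP => j; rewrite leq_eqVlt => /orP[/eqP<-|lt_nj].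
  by rewrite coefB gn subrr.
have h (p : {poly R}) : (size p <= n.+1)%N -> p`_j = 0.
  by move=> /leq_sizeP; apply.
by rewrite coefB !h ?subrr.
Qed.

End HilbertBasis.

Section Multivariate.

Lemma mpoly_hom_ext (R C : comNzRingType) n (g h : {rmorphism {mpoly R[n]} -> C}) :
  (forall c, g c%:MP = h c%:MP) -> (forall i, g 'X_i = h 'X_i) -> g =1 h.
Proof.
move=> hC hX p; rewrite (mpolyE p) !rmorph_sum; apply: eq_bigr => m _.
rewrite -mul_mpolyC !rmorphM hC; congr (_ * _).
rewrite mpolyXE_id !rmorph_prod; apply: eq_bigr => i _.
by rewrite !rmorphXn hX.
Qed.

Variables (R : comNzRingType) (n : nat).

Definition uni_to_multi : {rmorphism {poly {mpoly R[n]}} -> {mpoly R[n.+1]}} :=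
  horner_eval ('X_(@ord_max n) : {mpoly R[n.+1]}) \o map_poly (@mwiden n R).

Lemma uni_to_multiC (p : {mpoly R[n]}) : uni_to_multi p%:P = mwiden p.
Proof. by rewrite /= map_polyC /= /horner_eval hornerC. Qed.

Lemma uni_to_multiX : uni_to_multi 'X = 'X_ord_max.
Proof. by rewrite /= map_polyX /horner_eval hornerX. Qed.

Lemma muni_Xwiden (i : 'I_n) :
  muni ('X_(widen_ord (leqnSn n) i) : {mpoly R[n.+1]}) = ('X_i)%:P.
Proof.
rewrite muniE msuppX big_seq1 mcoeffX eqxx scale1r mnm1E.
rewrite -val_eqE /= ltn_eqF // expr0 alg_polyC; congr ('X_[_])%:P.
by apply/mnmP => j; rewrite mnmE !mnm1E -!val_eqE.
Qed.

Lemma muni_Xmax : muni ('X_ord_max : {mpoly R[n.+1]}) = 'X.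
Proof.
rewrite muniE msuppX big_seq1 mcoeffX eqxx scale1r mnm1E eqxx expr1.
have -> : [multinom U_(ord_max)%MM (widen_ord (leqnSn n) i) | i < n] = 0%MM.
  by apply/mnmP => j; rewrite mnmE mnm1E mnm0E -val_eqE /= gtn_eqF.
by rewrite mpolyX0 scale1r.
Qed.

Lemma muni_widen (p : {mpoly R[n]}) : muni (mwiden p) = p%:P.
Proof.
pose g : {rmorphism {mpoly R[n]} -> {poly {mpoly R[n]}}} := @muni n R \o @mwiden n R.
apply: (@mpoly_hom_ext R _ n g (polyC : {rmorphism _ -> _})) => [c|i] /=.
  by rewrite mwidenC muniC.
by rewrite mwidenX mnmwiden1 muni_Xwiden.
Qed.

Lemma uni_to_multiK : cancel uni_to_multi (@muni n R).
Proof.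
elim/poly_ind => [|q c IH]; first by rewrite !rmorph0.
rewrite (rmorphD uni_to_multi) (rmorphM uni_to_multi) uni_to_multiX uni_to_multiC.
by rewrite muniD muniM IH muni_widen muni_Xmax.
Qed.

Lemma muniK : cancel (@muni n R) uni_to_multi.
Proof.
pose g : {rmorphism {mpoly R[n.+1]} -> {mpoly R[n.+1]}} := uni_to_multi \o @muni n R.
apply: (@mpoly_hom_ext R _ n.+1 g idfun) => [c|i].
  change (uni_to_multi (muni c%:MP) = c%:MP).
  by rewrite muniC uni_to_multiC mwidenC.
change (uni_to_multi (muni ('X_i : {mpoly R[n.+1]})) = 'X_i).
have [[j ->]|->] : {j | i = widen_ord (leqnSn n) j} + {i = ord_max}.
- have [lt_in|le_ni] := ltnP i n; first by left; exists (Ordinal lt_in); apply: val_inj.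
  by right; apply: val_inj => /=; have := ltn_ord i; lia.
- by rewrite muni_Xwiden uni_to_multiC mwidenX mnmwiden1.
- by rewrite muni_Xmax uni_to_multiX.
Qed.

End Multivariate.

Theorem noetherian_mpoly (K : fieldType) n : noetherian {mpoly K[n]}.
Proof.
elim: n => [|n IH].
  apply: (@noetherian_fractions K _ (@mpolyC 0 K)); first exact: noetherian_field.
  move=> b; exists b@_0%MM, 1; rewrite rmorph1 mulr1; split; last exact: nvar0_mpolyC.
  by exists 1; rewrite mulr1.
apply: (@noetherian_fractions _ _ (uni_to_multi K n)); first exact: noetherian_poly.
move=> b; exists (muni b), 1; rewrite rmorph1 mulr1; split.
  by exists 1; rewrite mulr1.
by rewrite muniK.
Qed.

(** * Algebraic dependence in a polynomial ring *)

Section AlgebraicDependence.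

(** The box polynomial whose coefficients are listed by [v] in the lexicographic
    order of the exponent vectors. *)
Fixpoint box_coef (K : Type) (N k : nat) (v : nat -> K) (e : seq nat) : K :=
  match k, e with
  | k'.+1, i :: e' => box_coef N k' (fun j => v (i * N ^ k' + j)%N) e'
  | _, _ => v 0%N
  end.

Fixpoint box_monomial (C : comNzRingType) (N : nat) (l : seq C) (j : nat) : C :=
  if l is a :: l' then
    a ^+ (j %/ N ^ size l') * box_monomial N l' (j %% N ^ size l')
  else 1.

Lemma box_coef_nonzero (K : comNzRingType) N k (v : nat -> K) j :
  (j < N ^ k)%N -> v j <> 0 -> box_nonzero N k (box_coef N k v).
Proof.
elim: k v j => [|k IH] v j.
  by rewrite expn0 ltnS leqn0 => /eqP->; exists [::].
move=> lt_j vj.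
have Nk0 : (0 < N ^ k)%N by move: lt_j; rewrite expnS; case: (N ^ k)%N; rewrite ?muln0.
have lt_jk : (j %% N ^ k < N ^ k)%N by rewrite ltn_mod.
have [|e [sz lt_e ve]] := IH (fun i => v (j %/ N ^ k * N ^ k + i)%N) _ lt_jk.
  by rewrite -divn_eq.
exists (j %/ N ^ k :: e)%N; split=> //=; first by rewrite sz.
by rewrite lt_e andbT ltn_divLR // -expnS.
Qed.

Lemma box_eval_coef (K C : comNzRingType) (kappa : K -> C) N l (v : nat -> K) :
  box_eval kappa N l (box_coef N (size l) v) =
  \sum_(j < N ^ size l) kappa (v j) * box_monomial N l j.
Proof.
elim: l v => [|a l IH] v /=; first by rewrite expn0 big_ord1 mulr1.
rewrite expnS -[RHS](big_mkord xpredT (fun j => kappa (v j) *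
  (a ^+ (j %/ N ^ size l) * box_monomial N l (j %% N ^ size l)))).
rewrite big_nat_mul big_mkord; apply: eq_bigr => i _.
rewrite IH mulr_sumr mulSn -[X in _ = \sum_(X <= _ < _) _]add0n.
rewrite big_addn addnK big_mkord.
apply: eq_bigr => j _.
have Nk0 : (0 < N ^ size l)%N by apply: leq_ltn_trans (ltn_ord j).
rewrite [(j + _)%N]addnC divnMDl // divn_small ?ltn_ord // addn0 modnMDl modn_small //.
by rewrite mulrCA.
Qed.

Lemma msizeM_ltn (K : fieldType) n (p q : {mpoly K[n]}) a b :
  (msize p <= a.+1)%N -> (msize q <= b.+1)%N -> (msize (p * q) <= (a + b).+1)%N.
Proof.
have [->|p0] := eqVneq p 0; first by rewrite mul0r msize0.
have [->|q0] := eqVneq q 0; first by rewrite mulr0 msize0.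
rewrite msizeM // => hp hq; rewrite -subn1 leq_subLR.
by apply: leq_trans (leq_add hp hq) _; lia.
Qed.

Lemma msize_box_monomial (K : fieldType) n D N (l : seq {mpoly K[n]}) j :
  (forall p, p \in l -> (msize p <= D.+1)%N) -> (j < N ^ size l)%N ->
  (msize (box_monomial N l j) <= (size l * (N * D)).+1)%N.
Proof.
elim: l j => [|a l IH] j hD /=; first by rewrite msizeC oner_eq0.
move=> lt_j.
have Nk0 : (0 < N ^ size l)%N.
  by move: lt_j; rewrite expnS; case: (N ^ size l)%N; rewrite ?muln0.
rewrite mulSn; apply: msizeM_ltn; last first.
  by apply: IH; [move=> p pl; apply: hD; rewrite inE pl orbT | rewrite ltn_mod].
have : (j %/ N ^ size l < N)%N by rewrite ltn_divLR // -expnS.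
move: (j %/ _)%N => i lt_iN.
apply: (@leq_trans (i * D).+1); last by rewrite ltnS leq_mul2r (ltnW lt_iN) orbT.
elim: i {lt_iN} => [|i IHi]; first by rewrite expr0 msizeC oner_eq0.
by rewrite exprS mulSn; apply: msizeM_ltn => //; apply: hD; rewrite mem_head.
Qed.

Lemma card_bmultinom_leq n M : (#|{: 'X_{1..n < M}}| <= M ^ n)%N.
Proof.
case: M => [|M].
  by rewrite eq_card0 // => m; have := bmdeg m.
rewrite -[in X in (_ <= X ^ _)%N](card_ord M.+1).
rewrite -[in X in (_ <= _ ^ X)%N](card_ord n) -card_ffun.
pose f (m : 'X_{1..n < M.+1}) : {ffun 'I_n -> 'I_M.+1} := [ffun i => inord (m i)].
apply: (@leq_card _ _ f) => m m' /ffunP eqf.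
apply: val_inj; apply/mnmP => i; have := congr1 val (eqf i); rewrite !ffunE /=.
have lt_m (u : 'X_{1..n < M.+1}) : (u i < M.+1)%N.
  apply: leq_ltn_trans (bmdeg u); rewrite mdegE (bigD1 i) //=; exact: leq_addr.
by rewrite !inordK.
Qed.

(** The value of [N] makes the last of the [n + 1] factors of [N ^ n.+1] exceed the
    constant [(k * D).+1 ^ n]. *)
Lemma box_count n k D (N := ((k * D).+1 ^ n).+1) : (n < k)%N ->
  ((k * (N * D)).+1 ^ n < N ^ k)%N.
Proof.
move=> lt_nk; apply: (@leq_trans (N ^ n.+1)); last by rewrite leq_pexp2l.
apply: (@leq_ltn_trans ((N * (k * D).+1) ^ n)).
  case: n @N lt_nk => [|n] N _ //; rewrite leq_exp2r //.
  by rewrite mulnCA mulnS addnC -[X in (X <= _)%N]addn1 leq_add2l.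
by rewrite expnMn expnS mulnC ltn_mul2r expn_gt0 /= ltnSn.
Qed.

(** There are more monomials in [k > n] elements with exponents below a large [N]
    than monomials of [n] variables that can occur in them. *)
Theorem algebraic_dependence (K : fieldType) n (l : seq {mpoly K[n]}) :
  (n < size l)%N -> exists N c, box_nonzero N (size l) c /\
    box_eval (@mpolyC n K) N l c = 0.
Proof.
move=> lt_nk; set k := size l.
have [D hD] : exists D, forall p, p \in l -> (msize p <= D.+1)%N.
  exists (\max_(p <- l) msize p)%N => p pl.
  by apply: leqW; apply: (leq_bigmax_seq (F := fun p => msize p)).
set N := ((k * D).+1 ^ n).+1; pose M := (k * (N * D)).+1.
pose A := \matrix_(i < N ^ k, j < #|{: 'X_{1..n < M}}|)
  (box_monomial N l i)@_(enum_val j : 'X_{1..n < M}).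
have : (\rank A < N ^ k)%N.
  apply: leq_ltn_trans (rank_leq_col A) _.
  by apply: leq_ltn_trans (card_bmultinom_leq n M) _; apply: box_count.
rewrite -subn_gt0 -mxrank_ker lt0n mxrank_eq0 => /rowV0Pn[u /sub_kermxP uA u0].
pose v j := if insub j is Some i then u 0 i else 0.
exists N, (box_coef N k v); split.
  have [i ui] : exists i, u 0 i != 0.
    apply/existsP; apply: contraR u0; rewrite negb_exists => /forallP ui.
    by apply/eqP/rowP => i; rewrite mxE; apply/eqP; rewrite -[_ == _]negbK.
  apply: (@box_coef_nonzero _ _ _ _ i) => //.
  by rewrite /v valK; apply/eqP.
rewrite box_eval_coef; apply/mpolyP => m; rewrite mcoeff0 raddf_sum /=.
have [lt_mM|le_Mm] := ltnP (mdeg m) M; last first.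
  rewrite big1 // => i _; rewrite mcoeffCM memN_msupp_eq0 ?mulr0 //.
  by apply: msize_mdeg_ge; apply: leq_trans le_Mm; apply: msize_box_monomial.
have := congr1 (fun B : 'rV_ _ => B 0 (enum_rank (BMultinom lt_mM))) uA.
rewrite !mxE => {2}<-; apply: eq_bigr => i _.
by rewrite mcoeffCM mxE enum_rankK /v valK.
Qed.

End AlgebraicDependence.

(** * Regular and independent elements at a prime *)

Section PrimeParameters.

(** [x] becomes a nonzerodivisor modulo [J] after localizing at [P]. *)
Definition locally_nonzerodivisor (A : comNzRingType) (P J : A -> Prop) (x : A) :=
  forall h, J (x * h) -> exists s, ~ P s /\ J (s * h).

(** A form of the dimension formula height + coheight = [n] for the primes of a
    [K]-algebra: [f] is a sequence that becomes regular after localizing at the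
    prime, [tau] is algebraically independent over [K] modulo the prime. *)
Definition prime_parameters (K A : comNzRingType) (kappa : K -> A) (n : nat) :=
  forall P : A -> Prop, is_prime P -> exists f tau : seq A,
    [/\ size f + size tau = n, forall x, x \in f -> P x,
        regular_by (locally_nonzerodivisor P) (@zero_ideal A) f &
        forall N c, box_nonzero N (size tau) c -> ~ P (box_eval kappa N tau c)]%N.

Section Poly.
Variables (K A : comNzRingType) (kappa : K -> A).

Let ext (J : A -> Prop) : {poly A} -> Prop := fun F => forall k, J F`_k.

Let ext_ideal J : is_ideal J -> is_ideal (ext J).
Proof.
move=> iJ; split=> [k|F G JF JG k|F G JG k]; first by rewrite coef0; apply: ideal0.
  by rewrite coefD; apply: idealD.
by rewrite coefM; apply: ideal_sum => // i _; apply: idealM.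
Qed.

Let ext_adjoin J x : is_ideal J -> ext (adjoin J [:: x]) = adjoin (ext J) [:: x%:P].
Proof.
move=> iJ; apply: ideal_ext => F; split=> [h|].
  have {h} h k : exists a, J (F`_k - a * x) by apply/adjoin1P.
  have [a ha] := choice h.
  apply/(adjoin1P _ _ (ext_ideal iJ)); exists (\poly_(k < size F) a k) => k.
  rewrite coefB coefMC coef_poly; case: ltnP => // le_k.
  by rewrite mul0r subr0 nth_default //; apply: ideal0.
move=> /(adjoin1P _ _ (ext_ideal iJ))[G hG] k; apply/(adjoin1P _ _ iJ).
by exists G`_k; have := hG k; rewrite coefB coefMC.
Qed.

Let ext_zero : ext (@zero_ideal A) = @zero_ideal {poly A}.
Proof.
apply: ideal_ext => F; split=> [h|-> k]; last by rewrite coef0.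
by apply/polyP => k; rewrite h coef0.
Qed.

Let ext_nonzerodivisor (P : {poly A} -> Prop) J x : is_prime P -> is_ideal J ->
  locally_nonzerodivisor (fun a => P a%:P) J x ->
  locally_nonzerodivisor P (ext J) x%:P.
Proof.
move=> pP iJ nx H xH.
have {nx} h k : exists s, ~ P s%:P /\ J (s * H`_k).
  by apply: nx; have := xH k; rewrite coefCM.
have [s hs] := choice h.
exists (\prod_(k < size H) s k)%:P; split.
  by rewrite rmorph_prod; apply: prime_prod => // k; case: (hs k).
move=> k; rewrite coefCM; have [lt_k|le_k] := ltnP k (size H); last first.
  by rewrite nth_default // mulr0; apply: ideal0.
rewrite (bigD1 (Ordinal lt_k)) //= mulrAC; apply: idealMl => //.
by case: (hs k).
Qed.

(** Division of [H] by [F] from the top degree, with the leading coefficient of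
    [F] as denominator. *)
Let lead_nonzerodivisor (P : {poly A} -> Prop) J (F : {poly A}) :
  is_prime P -> is_ideal J -> ~ P (lead_coef F)%:P ->
  locally_nonzerodivisor P (ext J) F.
Proof.
move=> pP iJ ncP H; have iE := ext_ideal iJ; set c := lead_coef F in ncP *.
suff [n hn] : exists n, ext J (F * H) -> ext J ((c ^+ n)%:P * H).
  move=> /hn h; exists (c ^+ n)%:P; split=> //.
  by rewrite rmorphXn => Pc; apply: ncP; apply: prime_idealX pP Pc.
move: {2}(size H) (leqnn (size H)) => n; elim: n H => [|n IH] H.
  rewrite leqn0 size_poly_eq0 => /eqP->; exists 0%N => _.
  by rewrite mulr0; apply: ideal0.
move=> sH; pose H' := c%:P * H - (c * H`_n)%:P * 'X^n.
have [|m hm] := IH H'.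
  apply/leq_sizeP => j; rewrite leq_eqVlt => /orP[/eqP<-|lt_nj].
    by rewrite coefB !coefCM coefXn eqxx mulr1 subrr.
  rewrite coefB !coefCM coefXn gtn_eqF // mulr0 subr0 nth_default ?mulr0 //.
  exact: leq_trans sH _.
exists m.+1 => FH.
have Jtop : J (c * H`_n).
  have sF : (0 < size F)%N.
    rewrite lt0n size_poly_eq0; apply/eqP => F0; apply: ncP.
    by rewrite /c F0 lead_coef0 polyC0; apply: ideal0; case: pP.
  have := FH ((size F).-1 + n)%N.
  pose H0 := H - (H`_n)%:P * 'X^n.
  rewrite -{1}[H](subrK ((H`_n)%:P * 'X^n)) -/H0 mulrDr coefD mulrA coefMXn.
  rewrite ltnNge leq_addl /= addnK coefMC nth_default ?add0r //.
  apply: leq_trans (size_polyMleq _ _) _.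
  suff : (size H0 <= n)%N by move: (size F) (size H0) sF => a b; lia.
  apply/leq_sizeP => j; rewrite leq_eqVlt => /orP[/eqP<-|lt_nj].
    by rewrite coefB coefCM coefXn eqxx mulr1 subrr.
  rewrite coefB coefCM coefXn gtn_eqF // mulr0 subr0 nth_default //.
  exact: leq_trans sH _.
have JX : ext J ((c * H`_n)%:P * 'X^n).
  by move=> k; rewrite coefCM; apply: idealMl.
have hFH' : ext J (F * H').
  rewrite /H' mulrBr mulrCA; apply: (idealB iE); first exact: (idealM _ iE).
  exact: (idealM _ iE).
have -> : (c ^+ m.+1)%:P * H = (c ^+ m)%:P * H' + (c ^+ m)%:P * ((c * H`_n)%:P * 'X^n).
  by rewrite -mulrDr subrK mulrA -polyCM -exprSr.
apply: (idealD iE); first exact: hm.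
exact: (idealM _ iE).
Qed.

(** Let [q] be the contraction of the prime [P] of [A[X]].  If [P] is the extension of
    [q], then ['X] is algebraically independent of [tau] modulo [P].  Otherwise [P]
    contains a polynomial whose leading coefficient is outside [q], and this
    polynomial extends the regular sequence. *)
Theorem prime_parameters_poly n : prime_parameters kappa n ->
  prime_parameters (polyC \o kappa) n.+1.
Proof.
move=> hA P pP; have iP := prime_ideal pP.
have [f [tau [sz fP rf ind]]] := hA _ (preim_prime polyC pP).
have [rf' ef'] := regular_by_map ext_ideal ext_adjoin
  (fun J x iJ => @ext_nonzerodivisor P J x pP iJ) (zero_ideal_ideal A) rf.
rewrite ext_zero in rf' ef'.
have ev l N c : box_eval (polyC \o kappa) N (map polyC l) c = (box_eval kappa N l c)%:P.
  exact: (box_eval_morph kappa polyC).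
have [[F [k [PF nPk]]]|allP] := pselect (exists (F : {poly A}) k, P F /\ ~ P (F`_k)%:P).
  have {F k PF nPk} [F [PF nPF]] : exists F : {poly A}, P F /\ ~ P (lead_coef F)%:P.
    move: {2}(size F) (leqnn (size F)) => m.
    elim: m F PF nPk => [|m IH] F PF nPk sF.
      case: nPk; rewrite nth_default ?polyC0; first exact: ideal0.
      exact: leq_trans sF _.
    have [Pl|nPl] := pselect (P (lead_coef F)%:P); last by exists F.
    (* The leading term lies in [P], and removing it keeps the [k]-th coefficient,
       which is not in [P]. *)
    pose G := F - (lead_coef F)%:P * 'X^((size F).-1).
    apply: (IH G).
    - by apply: idealB => //; apply: idealMl.
    - rewrite coefB coefCM coefXn; case: eqP => [ek|_]; last by rewrite mulr0 subr0.
      by case: nPk; rewrite ek.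
    apply/leq_sizeP => j; rewrite leq_eqVlt => /orP[/eqP<-|lt_mj].
      rewrite coefB coefCM coefXn; case: eqP => [->|ne_m]; first by rewrite mulr1 subrr.
      rewrite mulr0 subr0 nth_default //.
      by move: (size F) sF ne_m => z; lia.
    rewrite coefB coefCM coefXn gtn_eqF; last first.
      by move: (size F) sF lt_mj => z; lia.
    by rewrite mulr0 subr0 nth_default //; move: (size F) sF lt_mj => z; lia.
  exists (rcons (map polyC f) F), (map polyC tau); split.
  - by rewrite size_rcons !size_map -sz.
  - by move=> x; rewrite mem_rcons inE => /orP[/eqP->|/mapP[y /fP Py ->]].
  - rewrite regular_by_rcons; last exact: zero_ideal_ideal.
    by split=> //; rewrite -ef'; apply: lead_nonzerodivisor => //; apply: adjoin_ideal.
  - by move=> N c; rewrite size_map ev; apply: ind.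
exists (map polyC f), ('X :: map polyC tau); split=> //.
- by rewrite /= !size_map -sz addnS.
- by move=> x /mapP[y /fP Py ->].
move=> N c /= [[|i e] [sz_e lt_e ce]] // PF.
move: sz_e lt_e => /= [sz_e] /andP[lt_iN lt_e].
apply: (ind N (fun e => c (i :: e))).
  by exists e; split=> //; rewrite sz_e size_map.
apply: contrapT => nPi; apply: allP; eexists; exists i; split; first exact: PF.
rewrite coef_sum (bigD1 (Ordinal lt_iN)) //= big1 ?addr0.
  by rewrite ev coefXnM /= ltnn subnn coefC eqxx; exact: nPi.
move=> j; rewrite -val_eqE /= => ne_ji; rewrite ev coefXnM coefC subn_eq0.
by case: ltngtP ne_ji.
Qed.

End Poly.

Theorem prime_parameters_iso (K A B : comNzRingType) (kappa : K -> A)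
    (g : {rmorphism A -> B}) (g' : {rmorphism B -> A}) n :
  cancel g g' -> cancel g' g ->
  prime_parameters kappa n -> prime_parameters (g \o kappa) n.
Proof.
move=> gK g'K hA P pP.
have [f [tau [sz fP rf ind]]] := hA _ (preim_prime g pP).
pose E (J : A -> Prop) : B -> Prop := fun y => J (g' y).
have iE J : is_ideal J -> is_ideal (E J).
  move=> iJ; split=> [|x y|a x]; rewrite /E ?rmorph0 ?rmorphD ?rmorphM.
  - exact: ideal0.
  - exact: idealD.
  - exact: idealM.
have hE J x : is_ideal J -> E (adjoin J [:: x]) = adjoin (E J) [:: g x].
  move=> iJ; apply: ideal_ext => y; split.
    move=> /(adjoin1P _ _ iJ)[a ha]; apply/(adjoin1P _ _ (iE _ iJ)).
    by exists (g a); rewrite /E rmorphB rmorphM !gK.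
  move=> /(adjoin1P _ _ (iE _ iJ))[a ha]; apply/(adjoin1P _ _ iJ).
  by exists (g' a); move: ha; rewrite /E rmorphB rmorphM gK.
have hN J x : is_ideal J -> locally_nonzerodivisor (fun a => P (g a)) J x ->
    locally_nonzerodivisor P (E J) (g x).
  move=> iJ nx h; rewrite /E rmorphM gK => /nx[s [nPs Js]].
  by exists (g s); split=> //; rewrite rmorphM gK.
have [rf' _] := regular_by_map iE hE hN (zero_ideal_ideal A) rf.
have E0 : E (@zero_ideal A) = @zero_ideal B.
  apply: ideal_ext => y; split; last by move->; rewrite /E rmorph0.
  by move=> h; rewrite /zero_ideal -[y]g'K h rmorph0.
exists (map g f), (map g tau); split.
- by rewrite !size_map.
- by move=> x /mapP[y /fP Py ->].
- by rewrite -E0.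
- by move=> N c; rewrite size_map box_eval_morph; apply: ind.
Qed.

Theorem prime_parameters_mpoly (K : fieldType) n :
  prime_parameters (@mpolyC n K) n.
Proof.
elim: n => [|n IH].
  move=> P [iP nP1 _]; exists [::], [::]; split=> //.
  move=> N c [[|? ?] [// _ _ /eqP c0]] /= Pc; apply: nP1.
  by rewrite -[1]mpolyC1 -(mulVf c0) mpolyCM; apply: idealM.
have := prime_parameters_iso (@uni_to_multiK K n) (@muniK K n) (prime_parameters_poly IH).
congr prime_parameters; apply: funext => c /=.
by rewrite map_polyC /= /horner_eval hornerC mwidenC.
Qed.

End PrimeParameters.

(** * Bounds from algebraic dependence *)

Section Bounds.
Variables (K P S B : comNzRingType) (kappa : {rmorphism K -> P}).
Variables (iota : {rmorphism P -> S}) (rho : {rmorphism S -> P}).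
Variables (phi : {rmorphism S -> B}) (n : nat).
Hypothesis rhoK : cancel iota rho.
Hypothesis ker_rho : forall x, rho x = 0 -> exists N, phi x ^+ N = 0.
Hypothesis dependent : forall l : seq P, (n < size l)%N ->
  exists N c, box_nonzero N (size l) c /\ box_eval kappa N l c = 0.
Hypothesis fractions : forall b, exists a s, is_unit (phi s) /\ b * phi s = phi a.

(** Up to units, the [b] are images of elements of [S], and so satisfy together
    with [tau] a polynomial relation up to a nilpotent. *)
Lemma dependence_bound (J : nat -> B -> Prop) (b : seq B) (tau : seq P) :
  (forall i, (i <= size b)%N -> is_ideal (J i)) ->
  (forall i, (i < size b)%N ->
     [/\ forall x, J i x -> J i.+1 x, J i.+1 b`_i & nonzerodivisor (J i) b`_i]) ->
  (forall N c m, box_nonzero N (size tau) c ->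
     ~ J (size b) (phi (iota (box_eval kappa N tau c)) ^+ m)) ->
  (size b + size tau <= n)%N.
Proof.
move=> iJ hJ ind; rewrite leqNgt; apply/negP => lt_n.
have [num hnum] := choice fractions.
pose l := map num b.
have [|N [c [c0 ev0]]] := dependent (l := map rho l ++ tau).
  by rewrite size_cat !size_map.
pose kB : {rmorphism K -> B} := phi \o (iota \o kappa).
have evS : rho (box_eval (iota \o kappa) N (l ++ map iota tau) c) = 0.
  rewrite -box_eval_morph map_cat -map_comp (eq_map rhoK) map_id.
  rewrite -[RHS]ev0; congr box_eval; apply: funext => x.
  exact: rhoK.
have [M evB] := ker_rho evS.
have [||||c' [m [c'0 h]]] := @dependence_descent _ _ kB J (map phi l)
  (map (phi \o iota) tau) N c M.
- by move=> i; rewrite !size_map; apply: iJ.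
- move=> i; rewrite !size_map => lt_ib; have [Jsub Jb nb] := hJ i lt_ib.
  have [s [[u su] eb]] := hnum b`_i.
  rewrite !(nth_map 0) ?size_map // -eb; split=> //.
    by apply: idealMl => //; apply: iJ.
  move=> x; rewrite -mulrA => /nb h.
  rewrite -[x]mul1r -su -mulrA mulrCA; apply: idealM => //; exact: iJ (ltnW lt_ib).
- by move: c0; rewrite size_cat !size_map.
- rewrite map_comp -map_cat.
  suff -> : box_eval kB N (map phi (l ++ map iota tau)) c ^+ M = 0.
    exact: ideal0 (iJ 0%N isT).
  by rewrite -evB -box_eval_morph.
move: h; rewrite !size_map; move: c'0; rewrite size_map => c'0.
have -> : box_eval kB N (map (phi \o iota) tau) c' = phi (iota (box_eval kappa N tau c')).
  by rewrite -!box_eval_morph -map_comp.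
exact: ind.
Qed.

Lemma regular_sequence_bound (Q : B -> Prop) (b : seq B) (tau : seq P) :
  is_ideal Q -> (forall x, x \in b -> Q x) ->
  regular_by nonzerodivisor (@zero_ideal B) b ->
  (forall N c m, box_nonzero N (size tau) c ->
     ~ Q (phi (iota (box_eval kappa N tau c)) ^+ m)) ->
  (size b + size tau <= n)%N.
Proof.
move=> iQ bQ rb ind; have i0 := zero_ideal_ideal B.
apply: (@dependence_bound (fun i => adjoin (@zero_ideal B) (take i b))).
- by move=> i _; apply: adjoin_ideal.
- move=> i lt_ib; split; last exact: regular_take.
    by move=> x; rewrite (take_nth 0) // adjoin_rcons; apply: adjoin_subl.
  by apply: adjoin_subr; rewrite (take_nth 0) // mem_rcons mem_head.
move=> N c m c0 h; apply: (ind N c m c0); move: h; rewrite take_size.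
by apply: adjoin_min => // x ->; apply: ideal0.
Qed.

Lemma prime_chain_bound (k : nat) (C : nat -> B -> Prop) (tau : seq P) :
  prime_chain k C ->
  (forall N c m, box_nonzero N (size tau) c ->
     ~ C k (phi (iota (box_eval kappa N tau c)) ^+ m)) ->
  (k + size tau <= n)%N.
Proof.
move=> [pC incC] ind.
have /choice[b hb] : forall i, exists x, (i < k)%N -> C i.+1 x /\ ~ C i x.
  by move=> i; case: ltnP => [/incC[_ [x hx]]|_]; [exists x | exists 0].
have szb : size (mkseq b k) = k by rewrite size_mkseq.
rewrite -{1}szb; apply: (@dependence_bound C); rewrite !szb //.
  by move=> i /pC /prime_ideal.
move=> i lt_ik; rewrite nth_mkseq //; have [Cb nCb] := hb i lt_ik.
split=> //; first by case: (incC i lt_ik).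
by move=> x; case: (pC i (ltnW lt_ik)) => _ _ CM /CM[].
Qed.

End Bounds.

(** * Localizations of a finite free extension *)

Section FiniteFree.
Variables (K P S : comNzRingType) (kappa : {rmorphism K -> P}).
Variables (iota : {rmorphism P -> S}) (rho : {rmorphism S -> P}) (n : nat).
Variables (I : S -> Prop) (W : finType) (coord : W -> S -> P) (e : W -> S).
(* [S / I] is a free [P]-module with basis [e] and coordinates [coord], and [rho]
   induces a retraction onto [P] with nilpotent kernel. *)
Hypothesis iI : is_ideal I.
Hypothesis rhoK : cancel iota rho.
Hypothesis ker_rho : forall x, rho x = 0 -> exists N, I (x ^+ N).
Hypothesis coordD : forall w, {morph coord w : x y / x + y}.
Hypothesis coordM : forall w c x, coord w (iota c * x) = c * coord w x.
Hypothesis coordE : forall (a : W -> P) w, coord w (\sum_v iota (a v) * e v) = a w.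
Hypothesis coordP : forall x, I x <-> forall w, coord w x = 0.
Hypothesis dependent : forall l : seq P, (n < size l)%N ->
  exists N c, box_nonzero N (size l) c /\ box_eval kappa N l c = 0.
Hypothesis parameters : prime_parameters kappa n.
Hypothesis noethS : noetherian S.

Let coord0 w : coord w 0 = 0.
Proof. by rewrite -[X in coord w X](mulr0 (iota 0)) coordM mul0r. Qed.

Let coordN w x : coord w (- x) = - coord w x.
Proof. by apply/eqP; rewrite -addr_eq0 -coordD addNr coord0. Qed.

Let coordB w x y : coord w (x - y) = coord w x - coord w y.
Proof. by rewrite coordD coordN. Qed.

Let coord_sum w (r : seq W) (F : W -> S) :
  coord w (\sum_(v <- r) F v) = \sum_(v <- r) coord w (F v).
Proof. by apply: (big_morph (coord w)); [apply: coordD | apply: coord0]. Qed.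

Let coord_congr w x y : I (x - y) -> coord w x = coord w y.
Proof. by move=> /coordP/(_ w)/eqP; rewrite coordB subr_eq0 => /eqP. Qed.

Let expand x : I (x - \sum_v iota (coord v x) * e v).
Proof. by apply/coordP => w; rewrite coordB coordE subrr. Qed.

(** The extension to [S] of an ideal of [P], together with [I]. *)
Let ext (J : P -> Prop) : S -> Prop := fun x => forall w, J (coord w x).

Let ext_ideal J : is_ideal J -> is_ideal (ext J).
Proof.
move=> iJ; split=> [w|x y Jx Jy w|a x Jx w].
- by rewrite coord0; apply: ideal0.
- by rewrite coordD; apply: idealD.
rewrite (@coord_congr _ _ (a * \sum_v iota (coord v x) * e v)); last first.
  by rewrite -mulrBr; apply: idealM => //; apply: expand.
rewrite mulr_sumr coord_sum; apply: ideal_sum => // v _.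
by rewrite mulrCA coordM; apply: idealMl.
Qed.

Variables (M : S -> Prop) (B : comNzRingType) (phi : {rmorphism S -> B}).
Hypothesis pM : is_prime M.
Hypothesis IM : forall x, I x -> M x.
Hypothesis phi_unit : forall s, ~ M s -> is_unit (phi s).
Hypothesis phi_frac : forall b, exists a s, ~ M s /\ b * phi s = phi a.
Hypothesis phi_ker : forall a, phi a = 0 <-> exists2 s, ~ M s & I (s * a).

Let MP : P -> Prop := fun x => M (iota x).

Let pMP : is_prime MP. Proof. exact: preim_prime. Qed.

Let nMM s t : ~ M s -> ~ M t -> ~ M (s * t).
Proof. by case: pM => _ _ MM nMs nMt /MM[]. Qed.

Let nonunitsP b : nonunits B b <-> exists a s, [/\ M a, ~ M s & b * phi s = phi a].
Proof.
split=> [nb|[a [s [Ma nMs ebs]]] [u bu]].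
  have [a [s [nMs ebs]]] := phi_frac b; exists a, s; split=> //.
  apply: contrapT => /phi_unit[u au]; apply: nb; exists (phi s * u).
  by rewrite mulrA ebs.
have [c [t [nMt eut]]] := phi_frac u.
have /phi_ker[r nMr] : phi (s * t - a * c) = 0.
  rewrite rmorphB !rmorphM -ebs -eut.
  have -> : b * phi s * (u * phi t) = (b * u) * (phi s * phi t) by ring.
  by rewrite bu mul1r subrr.
move=> /IM Mr; have iM := prime_ideal pM.
have : M (r * (s * t)).
  rewrite -[s * t](subrK (a * c)) mulrDr; apply: idealD => //.
  by apply: idealM => //; apply: idealMl.
by apply: nMM => //; apply: nMM.
Qed.

Let nonunits_phi a : nonunits B (phi a) -> M a.
Proof. by move=> h; apply: contrapT => /phi_unit. Qed.

Let local_B : is_ideal (nonunits B).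
Proof.
have iM := prime_ideal pM; split.
- by case=> u /eqP; rewrite mul0r eq_sym oner_eq0.
- move=> x y /nonunitsP[a [s [Ma nMs ex]]] /nonunitsP[b [t [Mb nMt ey]]].
  apply/nonunitsP; exists (a * t + b * s), (s * t); split; [|exact: nMM|].
    by apply: idealD => //; apply: idealMl.
  by rewrite rmorphD !rmorphM -ex -ey; ring.
- by move=> a x nx [u]; rewrite mulrAC mulrC => xu; apply: nx; exists (a * u).
Qed.

Let frac_unit b : exists a s, is_unit (phi s) /\ b * phi s = phi a.
Proof. by have [a [s [/phi_unit us eb]]] := phi_frac b; exists a, s. Qed.

(** The ideal generated by [J] in the localization [B] of [S / I]. *)
Let loc (J : P -> Prop) : B -> Prop :=
  fun b => exists s h, [/\ ~ M s, ext J h & b * phi s = phi h].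

Let locP (J : P -> Prop) b a s : is_ideal J -> ~ M s -> b * phi s = phi a ->
  loc J b <-> exists2 t, ~ M t & ext J (t * a).
Proof.
move=> iJ nMs eb; have iE := ext_ideal iJ.
have IE x : I x -> ext J x.
  by move=> /coordP Ix w; rewrite Ix; apply: ideal0.
split=> [[t [h [nMt Jh ebt]]]|[t nMt Jta]]; last first.
  exists (t * s), (t * a); split=> //; first exact: nMM.
  by rewrite !rmorphM -eb mulrCA.
have /phi_ker[r nMr Ir] : phi (t * a - s * h) = 0.
  by rewrite rmorphB !rmorphM -eb -ebt; ring.
exists (r * t); first exact: nMM.
rewrite -mulrA -[t * a](subrK (s * h)) mulrDr; apply: (idealD iE).
  exact: IE.
by do 2 apply: (idealM _ iE).
Qed.

Let loc_ideal J : is_ideal J -> is_ideal (loc J).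
Proof.
move=> iJ; have iE := ext_ideal iJ; split.
- by exists 1, 0; split; [case: pM | apply: ideal0 | rewrite rmorph0 mul0r].
- move=> x y [s [h [nMs Jh ex]]] [t [k [nMt Jk ey]]].
  exists (s * t), (h * t + k * s); split; [exact: nMM | | ].
    by apply: (idealD iE); apply: (idealMl _ iE).
  by rewrite rmorphD !rmorphM -ex -ey; ring.
- move=> b x [s [h [nMs Jh ex]]]; have [a [t [nMt eb]]] := phi_frac b.
  exists (s * t), (a * h); split; [exact: nMM | exact: (idealM _ iE) |].
  by rewrite !rmorphM -ex -eb; ring.
Qed.

Let loc_adjoin J x : is_ideal J ->
  loc (adjoin J [:: x]) = adjoin (loc J) [:: phi (iota x)].
Proof.
move=> iJ; have iE := ext_ideal iJ; have iL := loc_ideal iJ.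
apply: ideal_ext => b; split=> [[s [h [nMs hJ eb]]]|].
  have {}hJ w : exists a, J (coord w h - a * x) by apply/(adjoin1P _ _ iJ)/hJ.
  have [a ha] := choice hJ.
  pose h' := \sum_v iota (a v) * e v.
  have [u su] := phi_unit nMs.
  apply/(adjoin1P _ _ iL); exists (u * phi h').
  exists s, (h - iota x * h'); split=> //.
    by move=> w; rewrite coordB coordM coordE mulrC.
  rewrite rmorphB rmorphM mulrBl eb; congr (_ - _).
  have -> : u * phi h' * phi (iota x) * phi s = (phi s * u) * (phi (iota x) * phi h').
    by ring.
  by rewrite su mul1r.
move=> /(adjoin1P _ _ iL)[c [s [h [nMs Jh eb]]]].
have [a [t [nMt ec]]] := phi_frac c.
exists (s * t), (t * h + iota x * (s * a)); split; first exact: nMM.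
  move=> w; rewrite coordD coordM; apply: idealD; first exact: adjoin_ideal.
    by apply: adjoin_subl; apply: (idealM _ iE).
  apply: idealMl; first exact: adjoin_ideal.
  by apply: adjoin_subr; rewrite inE.
rewrite rmorphD !rmorphM -ec -eb; ring.
Qed.

Let loc_zero : loc (@zero_ideal P) = @zero_ideal B.
Proof.
apply: ideal_ext => b; split=> [[s [h [nMs h0 eb]]]|->].
  have [u su] := phi_unit nMs.
  rewrite /zero_ideal -[b]mulr1 -su mulrA eb.
  suff -> : phi h = 0 by rewrite mul0r.
  apply/phi_ker; exists 1; first by case: pM.
  by rewrite mul1r; apply/coordP.
exists 1, 0; split; [by case: pM | by move=> w; rewrite coord0 |].
by rewrite rmorph0 mul0r.
Qed.

Let loc_nonzerodivisor J x : is_ideal J ->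
  locally_nonzerodivisor MP J x -> nonzerodivisor (loc J) (phi (iota x)).
Proof.
move=> iJ nx b; have [a [s [nMs eb]]] := phi_frac b.
have eb' : phi (iota x) * b * phi s = phi (iota x * a) by rewrite rmorphM -eb mulrA.
move=> /(locP iJ nMs eb')[t nMt hx]; apply/(locP iJ nMs eb).
have {hx} hx w : exists r, ~ MP r /\ J (r * coord w (t * a)).
  by apply: nx; have := hx w; rewrite mulrCA coordM.
have [r hr] := choice hx.
exists (iota (\prod_w r w) * t).
  apply: nMM => //; suff : ~ MP (\prod_w r w) by [].
  by apply: prime_prod => // w; case: (hr w).
move=> w; rewrite -mulrA coordM (bigD1 w) //= mulrAC; apply: idealMl => //.
by case: (hr w).
Qed.

(** Both the dimension and the depth are the length of [f]: it is a regular
    sequence, and algebraic dependence together with [tau] bounds prime chains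
    and regular sequences. *)
Theorem localization_cohen_macaulay : cohen_macaulay_local B.
Proof.
have iQ := local_B.
have nQ1 : ~ nonunits B 1 by apply; exists 1; rewrite mulr1.
have pQ : is_prime (nonunits B).
  split=> // x y nxy; apply: contrapT => /not_orP[/contrapT[u xu] /contrapT[v yv]].
  by apply: nxy; exists (u * v); rewrite mulrACA xu yv mulr1.
have [f [tau [sz fP rf ind]]] := parameters pMP.
have [rf' _] := regular_by_map (g := phi \o iota) loc_ideal loc_adjoin
  loc_nonzerodivisor (zero_ideal_ideal P) rf.
rewrite loc_zero in rf'; set b := map _ f in rf'.
have i0 := zero_ideal_ideal B.
have bQ x : x \in b -> nonunits B x.
  move=> /mapP[y /fP My ->]; apply/nonunitsP.
  by exists (iota y), 1; split=> //; [case: pM | rewrite rmorph1 mulr1].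
have zQ x : @zero_ideal B x -> nonunits B x by move=> ->; apply: ideal0.
have indQ N c m : box_nonzero N (size tau) c ->
    ~ nonunits B (phi (iota (box_eval kappa N tau c)) ^+ m).
  by move=> /ind nM /(prime_idealX pQ) /nonunits_phi.
have ker_phi x : rho x = 0 -> exists N, phi x ^+ N = 0.
  move=> /ker_rho[N IN]; exists N; rewrite -rmorphXn; apply/phi_ker.
  by exists 1; rewrite ?mul1r //; case: pM.
split=> //.
  exact: noetherian_fractions noethS frac_unit.
have szb : size b = size f by rewrite size_map.
exists (size f); split; last first.
  rewrite -szb; apply: has_depthI => //.
    exact: noetherian_fractions noethS frac_unit.
  move=> x Qx nx.
  have := regular_sequence_bound rhoK ker_phi dependent frac_unit
    (b := rcons b x) (tau := tau) iQ.
  rewrite regular_by_rcons // size_rcons szb -sz => h.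
  suff : ((size f).+1 + size tau <= size f + size tau)%N by rewrite leq_add2r ltnn.
  by apply: h => // y; rewrite mem_rcons inE => /orP[/eqP->|/bQ].
split.
  rewrite -szb; apply: regular_prime_chain pQ _ zQ bQ rf' => //.
  exact: noetherian_fractions noethS frac_unit.
move=> k C chC; rewrite -(leq_add2r (size tau)) sz.
apply: (prime_chain_bound rhoK ker_phi dependent frac_unit chC) => N c m c0.
have [iC nC1 _] := chC.1 k (leqnn k).
move=> h; apply: (indQ N c m c0) => -[u xu]; apply: nC1; rewrite -xu.
exact: idealMl.
Qed.

End FiniteFree.

(** * Monomials in blocks of three variables *)

Section LinearExtension.
Variables (K : comNzRingType) (n : nat) (V : lmodType K) (g : 'X_{1..n} -> V).

Definition mpoly_linear (f : {mpoly K[n]}) : V := \sum_(m <- msupp f) f@_m *: g m.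

Lemma mpoly_linearwE k f : (msize f <= k)%N ->
  mpoly_linear f = \sum_(m : 'X_{1..n < k}) f@_m *: g m.
Proof.
move=> le_fk; rewrite /mpoly_linear.
rewrite (big_mksub 'X_{1..n < k}) /=; first last.
- by move=> m /msize_mdeg_lt /leq_trans; apply.
- exact: msupp_uniq.
rewrite big_rmcond //= => m /memN_msupp_eq0 ->; exact: scale0r.
Qed.

Lemma mpoly_linear_is_linear : linear mpoly_linear.
Proof.
move=> c p q; pose k := maxn (msize p) (maxn (msize q) (msize (c *: p + q))).
rewrite !(@mpoly_linearwE k); try by rewrite /k; lia.
rewrite scaler_sumr -big_split; apply: eq_bigr => m _ /=.
by rewrite mcoeffD mcoeffZ scalerDl scalerA.
Qed.

HB.instance Definition _ :=
  GRing.isLinear.Build K {mpoly K[n]} V *:%R mpoly_linear mpoly_linear_is_linear.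

Lemma mpoly_linearX m : mpoly_linear 'X_[m] = g m.
Proof. by rewrite /mpoly_linear msuppX big_seq1 mcoeffX eqxx scale1r. Qed.

End LinearExtension.

Lemma mpoly_lin_ind (K : comNzRingType) n (Q : {mpoly K[n]} -> Prop) :
  (forall m, Q 'X_[m]) -> (forall p q, Q p -> Q q -> Q (p + q)) ->
  (forall c p, Q p -> Q (c *: p)) -> forall p, Q p.
Proof.
move=> QX QD QZ p; rewrite (mpolyE p).
apply: (big_ind Q) => [|a b|m _]; [|exact: QD | exact: QZ].
by rewrite -(scale0r 'X_[0%MM]); apply: QZ.
Qed.

Lemma mpoly_alg_ind (K : comNzRingType) n (Q : {mpoly K[n]} -> Prop) :
  (forall c, Q c%:MP) -> (forall i, Q 'X_i) ->
  (forall p q, Q p -> Q q -> Q (p + q)) -> (forall p q, Q p -> Q q -> Q (p * q)) ->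
  forall p, Q p.
Proof.
move=> QC QX QD QM p; rewrite (mpolyE p).
apply: (big_ind Q) => [|a b|m _]; [by rewrite -mpolyC0 | exact: QD |].
rewrite -mul_mpolyC; apply: (QM) => //; rewrite mpolyXE_id.
apply: (big_ind Q) => [|a b|i _]; [by rewrite -mpolyC1 | exact: QM |].
by elim: (m i) => [|k IH]; rewrite ?expr0 -?mpolyC1 // exprS; apply: QM.
Qed.

Section Blocks.
Variable d : nat.
Implicit Types (u v : 'X_{1..3 * d}) (j : 'I_d).

Definition block_monomial (F : 'I_3 -> 'I_d -> nat) : 'X_{1..3 * d} :=
  [multinom (mxvec (\matrix_(k, j) F k j)) ord0 i | i < 3 * d].

Lemma block_monomialE F k j : block_monomial F (mxvec_index k j) = F k j.
Proof. by rewrite mnmE mxvecE mxE. Qed.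

Lemma mxvec_index_inj k k' j j' :
  (mxvec_index k j == mxvec_index k' j' :> 'I_(3 * d)) = (k == k') && (j == j').
Proof.
apply/eqP/andP => [|[/eqP-> /eqP->]] //.
move/(congr1 (fun i => mxvec (\matrix_(k, j) (k, j)) 0 i)).
by rewrite !mxvecE !mxE => -[-> ->].
Qed.

Definition xi j : 'I_(3 * d) := mxvec_index (inord 0 : 'I_3) j.
Definition yi j : 'I_(3 * d) := mxvec_index (inord 1 : 'I_3) j.
Definition zi j : 'I_(3 * d) := mxvec_index (inord 2 : 'I_3) j.

(** The degree in [t_j] of the image of the monomial [u] under the map sending
    [x_j], [y_j], [z_j] to [s_j t_j^2], [s_j t_j], [s_j]. *)
Definition wt u j := (2 * u (xi j) + u (yi j))%N.
Definition dg u j := (u (xi j) + u (yi j) + u (zi j))%N.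

Variant block_index_spec : 'I_(3 * d) -> Type :=
| IsX j : block_index_spec (xi j)
| IsY j : block_index_spec (yi j)
| IsZ j : block_index_spec (zi j).

Lemma block_indexP i : block_index_spec i.
Proof.
case/mxvec_indexP: i => k j.
have -> : k = inord k by rewrite inord_val.
by case: k => [[|[|[|//]]] /= _]; constructor.
Qed.

Lemma wtD u v j : wt (u + v)%MM j = (wt u j + wt v j)%N.
Proof. rewrite /wt !mnmDE; lia. Qed.
Lemma dgD u v j : dg (u + v)%MM j = (dg u j + dg v j)%N.
Proof. rewrite /dg !mnmDE; lia. Qed.

Lemma xi_eq j j' : (xi j == xi j') = (j == j').
Proof. by rewrite /xi mxvec_index_inj eqxx. Qed.
Lemma yi_eq j j' : (yi j == yi j') = (j == j').
Proof. by rewrite /yi mxvec_index_inj eqxx. Qed.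
Lemma zi_eq j j' : (zi j == zi j') = (j == j').
Proof. by rewrite /zi mxvec_index_inj eqxx. Qed.
Lemma xyi_eq j j' : (xi j == yi j') = false.
Proof. by rewrite mxvec_index_inj -val_eqE /= !inordK. Qed.
Lemma xzi_eq j j' : (xi j == zi j') = false.
Proof. by rewrite mxvec_index_inj -val_eqE /= !inordK. Qed.
Lemma yzi_eq j j' : (yi j == zi j') = false.
Proof. by rewrite mxvec_index_inj -val_eqE /= !inordK. Qed.

Definition block_eqE := (xi_eq, yi_eq, zi_eq, xyi_eq, xzi_eq, yzi_eq,
  fun j j' => etrans (eq_sym (yi j) (xi j')) (xyi_eq j' j),
  fun j j' => etrans (eq_sym (zi j) (xi j')) (xzi_eq j' j),
  fun j j' => etrans (eq_sym (zi j) (yi j')) (yzi_eq j' j)).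

Lemma wtx j j' : wt U_(xi j)%MM j' = (2 * (j == j'))%N.
Proof. by rewrite /wt !mnm1E !block_eqE addn0. Qed.
Lemma wty j j' : wt U_(yi j)%MM j' = (j == j').
Proof. by rewrite /wt !mnm1E !block_eqE. Qed.
Lemma wtz j j' : wt U_(zi j)%MM j' = 0%N.
Proof. by rewrite /wt !mnm1E !block_eqE. Qed.
Lemma dgz j j' : dg U_(zi j)%MM j' = (j == j').
Proof. by rewrite /dg !mnm1E !block_eqE. Qed.
Lemma dgx j j' : dg U_(xi j)%MM j' = (j == j').
Proof. by rewrite /dg !mnm1E !block_eqE !addn0. Qed.
Lemma dgy j j' : dg U_(yi j)%MM j' = (j == j').
Proof. by rewrite /dg !mnm1E !block_eqE addn0. Qed.
Lemma wt_dg u j : ((0 < wt u j) <= dg u j)%N.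
Proof. rewrite /wt /dg; lia. Qed.

Lemma mdeg_dg u : mdeg u = (\sum_j dg u j)%N.
Proof.
rewrite mdegE (reindex _ (curry_mxvec_bij _ _)) /=.
rewrite (eq_bigr (fun p => u (mxvec_index p.1 p.2))); last by case.
rewrite -(pair_bigA _ (fun k j => u (mxvec_index k j))) /= exchange_big.
apply: eq_bigr => j _; rewrite !big_ord_recl big_ord0 /= addn0 addnA /dg.
by congr (u _ + u _ + u _)%N; congr mxvec_index; apply: val_inj; rewrite /= inordK.
Qed.

End Blocks.

(** * The ideal *)

Section BlockIdeal.
Variables (K : fieldType) (d : nat).
Local Notation S := {mpoly K[3 * d]}.
Local Notation P := {mpoly K[d]}.
Implicit Types (w : {ffun 'I_d -> 'I_3}) (u v : 'X_{1..3 * d}) (f : S).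

Definition has_wt w u := [forall j, wt u j == w j].

(** The exponents of [s] in the image of [u], after division by the product of the
    [s_j] with [w j > 0]. *)
Definition residue w u : 'X_{1..d} := [multinom (dg u j - (0 < w j))%N | j < d].

(** The component of weight [w] of the image of [f] in [K[s, t] / (t_j^3)],
    divided by the product of the [s_j] with [w j > 0]. *)
Definition coord w : S -> P :=
  mpoly_linear (fun u => if has_wt w u then 'X_[residue w u] else 0).

Lemma coord0 w : coord w 0 = 0. Proof. exact: linear0. Qed.
Lemma coordD w f g : coord w (f + g) = coord w f + coord w g.
Proof. exact: linearD. Qed.
Lemma coordZ w c f : coord w (c *: f) = c *: coord w f.
Proof. exact: linearZ. Qed.
Lemma coord_sum w (I : finType) (F : I -> S) :
  coord w (\sum_i F i) = \sum_i coord w (F i).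
Proof. exact: linear_sum. Qed.

Lemma coordX w u : coord w 'X_[u] = if has_wt w u then 'X_[residue w u] else 0.
Proof. exact: mpoly_linearX. Qed.

Definition wt_sub w v : {ffun 'I_d -> 'I_3} := [ffun j => inord (w j - wt v j)].

Definition residue_sub w v : 'X_{1..d} :=
  [multinom (dg v j + (0 < wt_sub w v j) - (0 < w j))%N | j < d].

Lemma wt_subE w v j : wt_sub w v j = (w j - wt v j)%N :> nat.
Proof. rewrite ffunE inordK //; have := ltn_ord (w j); lia. Qed.

(** The source of both the ideal property and the [P]-linearity of the coordinates:
    the coordinates of ['X_[v] * f] are multiples of coordinates of [f]. *)
Lemma coord_mulX w v f : coord w ('X_[v] * f) =
  if [forall j, wt v j <= w j]%N then 'X_[residue_sub w v] * coord (wt_sub w v) f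
  else 0.
Proof.
elim/mpoly_lin_ind: f => [u|p q hp hq|c p hp].
- rewrite -mpolyXD !coordX.
  have -> : has_wt w (v + u)%MM =
      [forall j, wt v j <= w j]%N && has_wt (wt_sub w v) u.
    apply/forallP/andP => [h|[/forallP h1 /forallP h2] j].
      by split; apply/forallP => j; have := h j; rewrite ?wt_subE wtD; lia.
    by have := h1 j; have := h2 j; rewrite wt_subE wtD; lia.
  case: (boolP [forall j, _]) => [/forallP h1|_] //=.
  case: (boolP (has_wt _ _)) => [/forallP h2|_]; last by rewrite mulr0.
  rewrite -mpolyXD; congr 'X_[_]; apply/mnmP => j.
  have := h2 j; have := h1 j; rewrite !mnmE dgD !wt_subE.
  have := wt_dg u j; have := wt_dg v j; lia.
- by rewrite mulrDr [LHS]coordD hp hq; case: ifP => _; rewrite ?addr0 // coordD mulrDr.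
- rewrite -scalerAr [LHS]coordZ hp; case: ifP => _; rewrite ?scaler0 //.
  by rewrite coordZ scalerAr.
Qed.

Definition block_ideal : pred S := fun f => [forall w, coord w f == 0].

Lemma block_idealP f : reflect (forall w, coord w f = 0) (f \in block_ideal).
Proof. by apply: (iffP forallP) => h w; apply/eqP. Qed.

Definition wt0 : {ffun 'I_d -> 'I_3} := [ffun=> ord0].

Lemma coord_wt0_1 : coord wt0 1 = 1.
Proof.
rewrite -mpolyX0 coordX ifT; last first.
  by apply/forallP => j; rewrite ffunE /wt !mnm0E.
by rewrite -mpolyX0; congr 'X_[_]; apply/mnmP => j; rewrite mnmE ffunE /dg !mnm0E.
Qed.

Fact block_ideal_closed : idealr_closed block_ideal.
Proof.
split=> [||a f g /block_idealP hf /block_idealP hg].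
- by apply/block_idealP => w; rewrite coord0.
- by apply/block_idealP => /(_ wt0)/eqP; rewrite coord_wt0_1 oner_eq0.
apply/block_idealP => w; rewrite coordD hg addr0.
elim/mpoly_lin_ind: a => [v|p q hp hq|c p hp].
- by rewrite coord_mulX hf mulr0 if_same.
- by rewrite mulrDl coordD hp hq addr0.
- by rewrite -scalerAl coordZ hp scaler0.
Qed.

HB.instance Definition _ := isIdealr.Build S block_ideal block_ideal_closed.

Lemma coordXz w j f : coord w ('X_(zi j) * f) = 'X_j * coord w f.
Proof.
rewrite coord_mulX ifT; last by apply/forallP => j'; rewrite wtz.
have -> : wt_sub w U_(zi j)%MM = w.
  by apply/ffunP => j'; apply: val_inj; rewrite /= wt_subE wtz subn0.
congr ('X_[_] * _); apply/mnmP => j'.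
by rewrite mnmE wt_subE wtz subn0 addnK dgz mnm1E.
Qed.

(** The inclusion of [P = K[z]]; [rho] below sends all [x_j] and [y_j] to zero. *)
Definition iota : P -> S := mmap (@mpolyC (3 * d) K) (fun j => 'X_(zi j)).
HB.instance Definition _ := GRing.RMorphism.on iota.

Definition rho : S -> P := mmap (@mpolyC d K)
  (fun i => mxvec (\matrix_(k < 3, j < d) if k == inord 2 then 'X_j else 0) 0 i).
HB.instance Definition _ := GRing.RMorphism.on rho.

Lemma iotaD p q : iota (p + q) = iota p + iota q. Proof. exact: rmorphD. Qed.
Lemma iotaM p q : iota (p * q) = iota p * iota q. Proof. exact: rmorphM. Qed.
Lemma rhoD f g : rho (f + g) = rho f + rho g. Proof. exact: rmorphD. Qed.
Lemma rhoM f g : rho (f * g) = rho f * rho g. Proof. exact: rmorphM. Qed.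
Lemma iotaC c : iota c%:MP = c%:MP. Proof. exact: mmapC. Qed.
Lemma iotaX j : iota 'X_j = 'X_(zi j). Proof. by rewrite /iota mmapX mmap1U. Qed.
Lemma rhoC c : rho c%:MP = c%:MP. Proof. exact: mmapC. Qed.
Lemma rhoz j : rho 'X_(zi j) = 'X_j.
Proof. by rewrite /rho mmapX mmap1U mxvecE mxE eqxx. Qed.
Lemma rhox j : rho 'X_(xi j) = 0.
Proof. by rewrite /rho mmapX mmap1U mxvecE mxE -val_eqE /= !inordK. Qed.
Lemma rhoy j : rho 'X_(yi j) = 0.
Proof. by rewrite /rho mmapX mmap1U mxvecE mxE -val_eqE /= !inordK. Qed.

Lemma iotaK : cancel iota rho.
Proof.
move=> p; elim/mpoly_alg_ind: p => [c|j|p q hp hq|p q hp hq].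
- by rewrite iotaC rhoC.
- by rewrite iotaX rhoz.
- by rewrite iotaD rhoD hp hq.
- by rewrite iotaM rhoM hp hq.
Qed.

Lemma coord_iotaM w c f : coord w (iota c * f) = c * coord w f.
Proof.
elim/mpoly_alg_ind: c f => [c|j|p q hp hq|p q hp hq] f.
- by rewrite iotaC !mul_mpolyC coordZ.
- by rewrite iotaX coordXz.
- by rewrite iotaD !mulrDl coordD hp hq.
- by rewrite iotaM -!mulrA hp hq.
Qed.

(** The product of the [1], [y_j] or [x_j] according to [w j = 0], [1] or [2]. *)
Definition basis_monomial w : 'X_{1..3 * d} := block_monomial
  (fun k j => if k == inord 0 then nat_of_bool (w j == 2 :> nat) else
              if k == inord 1 then nat_of_bool (w j == 1 :> nat) else 0)%N.

Lemma basis_monomial_wt w j : wt (basis_monomial w) j = w j.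
Proof.
rewrite /wt !block_monomialE -!val_eqE /= !inordK //=.
by case: (w j) => [[|[|[|]]]].
Qed.

Lemma basis_monomial_dg w j : dg (basis_monomial w) j = (0 < w j)%N.
Proof.
rewrite /dg !block_monomialE -!val_eqE /= !inordK //=.
by case: (w j) => [[|[|[|]]]].
Qed.

Lemma coord_basis w w' : coord w 'X_[basis_monomial w'] = (w' == w)%:R.
Proof.
rewrite coordX; have -> : has_wt w (basis_monomial w') = (w' == w).
  apply/forallP/eqP => [h|-> j]; last by rewrite basis_monomial_wt.
  by apply/ffunP => j; apply: val_inj; rewrite /= -basis_monomial_wt; apply/eqP.
case: eqP => // ->; rewrite -mpolyX0; congr 'X_[_]; apply/mnmP => j.
by rewrite mnmE mnm0E basis_monomial_dg subnn.
Qed.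

Lemma coord_expansion (a : {ffun 'I_d -> 'I_3} -> P) w :
  coord w (\sum_w' iota (a w') * 'X_[basis_monomial w']) = a w.
Proof.
rewrite coord_sum (bigD1 w) //= coord_iotaM coord_basis eqxx mulr1 big1 ?addr0 //.
by move=> w' /negPf ne; rewrite coord_iotaM coord_basis ne mulr0.
Qed.

Lemma block_ideal_is_ideal : is_ideal (fun f => f \in block_ideal).
Proof.
have [h0 _ h] := block_ideal_closed; split=> // [f g If Ig|a f If].
  by rewrite -[f]mul1r; apply: h.
by rewrite -[_ * _]addr0; apply: h.
Qed.

(** The radical of the ideal contains every [x_j] and [y_j], their cubes having weight
    at least 3. *)
Lemma sub_iota_rho_radical f : radical (fun g => g \in block_ideal) (f - iota (rho f)).
Proof.
have iR := radical_ideal block_ideal_is_ideal.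
have cubeX i : (forall w, exists j, (w j < 3 * wt U_(i)%MM j)%N) ->
    radical (fun g => g \in block_ideal) 'X_i.
  move=> h; exists 3%N; rewrite mpolyXn; apply/block_idealP => w; rewrite coordX ifF //.
  apply/negP => /forallP hw; have [j] := h w; have /eqP := hw j.
  by rewrite mulmSr mulmSr mulm1n !wtD; lia.
elim/mpoly_alg_ind: f => [c|i|p q hp hq|p q hp hq].
- by rewrite rhoC iotaC subrr; apply: ideal0.
- case: (block_indexP i) => j.
  + rewrite rhox rmorph0 subr0; apply: cubeX => w; exists j.
    by rewrite wtx eqxx; have := ltn_ord (w j); lia.
  + rewrite rhoy rmorph0 subr0; apply: cubeX => w; exists j.
    by rewrite wty eqxx; have := ltn_ord (w j); lia.
  + by rewrite rhoz iotaX subrr; apply: ideal0.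
- by rewrite rhoD iotaD; apply: (ideal_congrD iR hp hq).
- by rewrite rhoM iotaM; apply: (ideal_congrM iR hp hq).
Qed.

Lemma ker_rho_radical f : rho f = 0 -> exists n, f ^+ n \in block_ideal.
Proof. by move=> rf; have := sub_iota_rho_radical f; rewrite rf rmorph0 subr0. Qed.

(** By [sub_iota_rho_radical] some power of [rho f] in [P] vanishes in the free
    [P]-module [S / I]. *)
Lemma block_ideal_ker_rho f : f \in block_ideal -> rho f = 0.
Proof.
move=> If; have iR := radical_ideal block_ideal_is_ideal.
have Rf : radical (fun g => g \in block_ideal) f by exists 1%N; rewrite expr1.
have := idealB iR Rf (sub_iota_rho_radical f); rewrite subKr => -[n].
have -> : iota (rho f) ^+ n = iota (rho f ^+ n) * 1.
  by rewrite mulr1; apply/esym; apply: rmorphXn.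
move=> /block_idealP/(_ wt0).
rewrite coord_iotaM coord_wt0_1 mulr1 => /eqP; rewrite expf_eq0 => /andP[_ /eqP] //.
Qed.

Lemma pihomog_mdegX (n k : nat) (m : 'X_{1..n}) :
  pihomog mdeg k ('X_[m] : {mpoly K[n]}) = if mdeg m == k then 'X_[m] else 0.
Proof. exact: pihomogX. Qed.

(** The coordinate of weight [w] lowers degrees by the number of [j] with
    [w j > 0]. *)
Lemma block_ideal_homogeneous : homogeneous_ideal block_ideal.
Proof.
move=> f k /block_idealP If; apply/block_idealP => w.
pose s := (\sum_j (0 < w j))%N.
suff -> : coord w (pihomog mdeg k f) =
    if (s <= k)%N then pihomog mdeg (k - s) (coord w f) else 0.
  by rewrite If pihomog0 if_same.
elim/mpoly_lin_ind: f {If} => [u|p q hp hq|c p hp].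
- rewrite pihomog_mdegX coordX.
  case: (boolP (has_wt w u)) => hw; last first.
    rewrite pihomog0 if_same; case: eqP => // _; last by rewrite coord0.
    by rewrite coordX (negPf hw).
  have degu : mdeg u = (mdeg (residue w u) + s)%N.
    rewrite mdeg_dg mdegE -big_split /=; apply: eq_bigr => j _.
    by rewrite mnmE subnK //; move/forallP: hw => /(_ j)/eqP <-; apply: wt_dg.
  rewrite pihomog_mdegX degu; case: leqP => [le_sk|lt_ks].
    have -> : (mdeg (residue w u) + s == k)%N = (mdeg (residue w u) == k - s)%N.
      by apply/eqP/eqP; lia.
    by case: eqP => _; rewrite ?coord0 // coordX hw.
  by case: eqP => [e|_]; [lia | rewrite coord0].
- by rewrite pihomogD !coordD hp hq; case: ifP => _; rewrite ?addr0 // pihomogD.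
- by rewrite linearZ !coordZ hp; case: ifP => _; rewrite ?scaler0 // linearZ.
Qed.

End BlockIdeal.
Arguments block_ideal : clear implicits.

(** * The quotient ring *)

Section Quotient.
Local Open Scope quotient_scope.
Variables (K : fieldType) (d : nat).
Local Notation S := {mpoly K[3 * d]}.
Local Notation P := {mpoly K[d]}.
Local Notation A := {ideal_quot (block_ideal K d : idealr S)}.

Let proj : {rmorphism S -> A} := \pi_A.

Let proj0 f : proj f = 0 <-> f \in block_ideal K d.
Proof.
rewrite -[f in X in _ <-> X]subr0 -(rmorph0 proj).
split=> [/eqP|h]; last apply/eqP; by rewrite -Quotient.idealrBE.
Qed.

Let proj_surj a : exists f, a = proj f.
Proof. by exists (repr a); rewrite /proj /= reprK. Qed.

Let rho_m : {rmorphism S -> P} := @rho K d.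
Let iota_m : {rmorphism P -> S} := @iota K d.
Let const_m : {rmorphism K -> P} := @mpolyC d K.

Theorem block_ideal_cohen_macaulay : cohen_macaulay A.
Proof.
have noethS := @noetherian_mpoly K (3 * d).
split.
  apply: (noetherian_fractions (phi := proj)) noethS _ => b.
  have [f ->] := proj_surj b; exists f, 1; rewrite rmorph1 mulr1; split=> //.
  by exists 1; rewrite mulr1.
move=> M /maximal_prime pM B phi [phi_unit phi_frac phi_ker].
pose psi : {rmorphism S -> B} := phi \o proj.
apply: (@localization_cohen_macaulay K P S const_m iota_m rho_m d
  (fun f => f \in block_ideal K d) _ (@coord K d) (fun w => 'X_[basis_monomial w])
  _ _ _ _ _ _ _ _ _ _ (fun f => M (proj f)) B psi).
- exact: block_ideal_is_ideal.
- exact: iotaK.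
- exact: ker_rho_radical.
- by move=> w f g; apply: coordD.
- exact: coord_iotaM.
- exact: coord_expansion.
- by move=> f; split=> /block_idealP.
- exact: algebraic_dependence.
- exact: prime_parameters_mpoly.
- exact: noethS.
- exact: preim_prime.
- by move=> f /proj0 ->; apply: ideal0; case: pM.
- by move=> s nMs; apply: phi_unit.
- move=> b; have [a [s [nMs eb]]] := phi_frac b.
  have [f ef] := proj_surj a; have [g eg] := proj_surj s.
  by exists f, g; rewrite /psi /= -ef -eg.
move=> f; rewrite /psi /= phi_ker; split=> [[s nMs sf]|[s nMs /proj0 sf]].
  have [g eg] := proj_surj s; exists g; first by rewrite -eg.
  by apply/proj0; rewrite rmorphM -eg.
by exists (proj s) => //; rewrite -rmorphM.
Qed.

Let kill (i : nat) : P -> P :=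
  mmap (@mpolyC d K) (fun j => if (j < i)%N then 0 else 'X_j).
HB.instance Definition _ i := GRing.RMorphism.on (kill i).

Let killX i (j : 'I_d) : kill i 'X_j = if (j < i)%N then 0 else 'X_j.
Proof. by rewrite /kill mmapX mmap1U. Qed.

Let killD i p q : kill i (p + q) = kill i p + kill i q.
Proof. exact: rmorphD. Qed.
Let killM i p q : kill i (p * q) = kill i p * kill i q.
Proof. exact: rmorphM. Qed.

Let kill_kill i p : kill i.+1 (kill i p) = kill i.+1 p.
Proof.
elim/mpoly_alg_ind: p => [c|j|p q hp hq|p q hp hq].
- by rewrite /kill !mmapC.
- rewrite [kill i _]killX; case: ifP => [lt_ji|_] //.
  by rewrite rmorph0 killX (ltnW lt_ji : (j < i.+1)%N).
- by rewrite !killD hp hq.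
- by rewrite !killM hp hq.
Qed.

Let kill_rho i : {rmorphism S -> P} := kill i \o rho_m.

(** The chain consists of the kernels of the maps to [K[z]] that kill all [x_j] and
    [y_j], and the first [i] of the [z_j]. *)
Theorem block_ideal_krull_dim : has_krull_dim A d.
Proof.
split.
  pose C i (a : A) := exists2 f, a = proj f & kill_rho i f = 0.
  have CP i f : C i (proj f) <-> kill_rho i f = 0.
    split=> [[g /eqP efg hg]|]; last by exists f.
    rewrite -subr_eq0 -rmorphB in efg.
    move/eqP/proj0/block_ideal_ker_rho: efg => efg.
    have : kill_rho i (f - g) = 0 by rewrite /kill_rho /= efg rmorph0.
    by rewrite rmorphB hg subr0.
  exists C; split=> [i _|i lt_id].
    split.
    - split=> [|a b|a b].
      + by rewrite -(rmorph0 proj); apply/CP; rewrite !rmorph0.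
      + have [f ->] := proj_surj a; have [g ->] := proj_surj b.
        by move=> /CP ha /CP hb; rewrite -rmorphD; apply/CP; rewrite !rmorphD ha hb addr0.
      + have [f ->] := proj_surj a; have [g ->] := proj_surj b.
        by move=> /CP hb; rewrite -rmorphM; apply/CP; rewrite !rmorphM hb mulr0.
    - by rewrite -(rmorph1 proj) => /CP; rewrite !rmorph1 => /eqP; rewrite oner_eq0.
    - move=> a b; have [f ->] := proj_surj a; have [g ->] := proj_surj b.
      rewrite -rmorphM => /CP; rewrite !rmorphM => /eqP; rewrite mulf_eq0.
      by move=> /orP[/eqP h|/eqP h]; [left | right]; apply/CP.
  split.
    move=> a; have [f ->] := proj_surj a => /CP h; apply/CP.
    change (kill i.+1 (rho_m f) = 0); rewrite -kill_kill.
    by move: h; rewrite /kill_rho /= => ->; rewrite rmorph0.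
  exists (proj 'X_(zi (Ordinal lt_id))); rewrite !CP /kill_rho /= rhoz !killX /=.
  rewrite ltnSn ltnn; split=> // /(congr1 (mcoeff U_(Ordinal lt_id)%MM))/eqP.
  by rewrite mcoeffXU eqxx mcoeff0 oner_eq0.
move=> k C chC.
have := @prime_chain_bound K P S A const_m iota_m rho_m proj d (@iotaK K d) _
  (@algebraic_dependence K d) _ k C [::] chC.
rewrite addn0; apply.
- move=> f /ker_rho_radical[n If]; exists n; rewrite -rmorphXn; exact/proj0.
- move=> b; have [f ->] := proj_surj b; exists f, 1; rewrite rmorph1 mulr1.
  by split=> //; exists 1; rewrite mulr1.
have [pC _] := chC; have pCk := pC k (leqnn k).
move=> N c m [e [/size0nil-> _ /eqP c0]] /(prime_idealX pCk) /= h.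
case: pCk => iC nC1 _; apply: nC1.
rewrite -[1](rmorph1 proj) -(rmorph1 iota_m) -(rmorph1 const_m) -(mulVf c0).
by rewrite !rmorphM; apply: idealM.
Qed.

End Quotient.

(** * Monomial ideals *)

Section MonomialIdeals.
Variables (K : fieldType) (n : nat).
Local Notation S := {mpoly K[n]}.
Implicit Types (E : pred 'X_{1..n}) (u v : 'X_{1..n}).

Definition upward_closed E := forall u v, E u -> E (v + u)%MM.

Definition monomial_ideal E : S -> Prop := fun f => forall u, u \in msupp f -> E u.

Lemma monomial_idealX E u : monomial_ideal E 'X_[u] <-> E u.
Proof.
split=> [|Eu v]; first by apply; rewrite msuppX mem_head.
by rewrite msuppX inE => /eqP->.
Qed.

Lemma monomial_ideal_ideal E : upward_closed E -> is_ideal (monomial_ideal E).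
Proof.
move=> upE; split=> [u|f g Ef Eg u /msuppD_le|a f Ef u /msuppM_le].
- by rewrite msupp0.
- by rewrite mem_cat => /orP[/Ef|/Eg].
- by move=> /allpairsP[[v v'] /= [_ /Ef Ev' ->]]; apply: upE.
Qed.

Lemma monomial_ideal_sub E (J : S -> Prop) : is_ideal J ->
  (forall u, E u -> J 'X_[u]) -> forall f, monomial_ideal E f -> J f.
Proof.
move=> iJ EJ f Ef; rewrite (mpolyE f) big_seq; apply: ideal_sum => // u /Ef Eu.
by rewrite -mul_mpolyC; apply: idealM => //; apply: EJ.
Qed.

Lemma monomial_ideal_adjoin E E' i : upward_closed E -> upward_closed E' ->
  (forall u, E' u = E u || (0 < u i)%N) ->
  adjoin (monomial_ideal E) [:: 'X_i] = monomial_ideal E'.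
Proof.
move=> upE upE' hE'; have iE := adjoin_ideal (monomial_ideal E) [:: 'X_i].
apply: ideal_ext => f; split.
  apply: adjoin_min; first exact: monomial_ideal_ideal.
    by move=> g Eg u /Eg Eu; rewrite hE' Eu.
  by move=> g; rewrite inE => /eqP->; apply/monomial_idealX; rewrite hE' mnm1E eqxx orbT.
apply: monomial_ideal_sub => // u; rewrite hE' => /orP[Eu|u_i].
  by apply: adjoin_subl; apply/monomial_idealX.
have le_iu : (U_(i) <= u)%MM by rewrite lep1mP -lt0n.
rewrite -(submK le_iu) mpolyXD; apply: idealM => //.
by apply: adjoin_subr; rewrite inE.
Qed.

Lemma monomial_nonzerodivisor E i : (forall u, E (U_(i) + u)%MM -> E u) ->
  nonzerodivisor (monomial_ideal E) 'X_i.
Proof.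
move=> cancelE f Ef u uf; apply: cancelE; apply: Ef.
by rewrite mcoeff_msupp -commr_mpolyX mcoeffMX -mcoeff_msupp.
Qed.

Lemma graded_maximal_ideal_proper : ~ graded_maximal_ideal K n 1.
Proof.
suff h f : graded_maximal_ideal K n f -> f@_0%MM = 0.
  by move/h/eqP; rewrite mcoeff1 eqxx oner_eq0.
move: f; apply: ideal_gen_min.
  split=> [|f g f0 g0|a f f0]; first by rewrite mcoeff0.
    by rewrite mcoeffD f0 g0 addr0.
  by rewrite rmorphM /= f0 mulr0.
by move=> _ [i ->]; rewrite mcoeffX mnm1_eq0.
Qed.

Lemma monomial_ideal_graded_maximal E : ~~ E 0%MM ->
  forall f, monomial_ideal E f -> graded_maximal_ideal K n f.
Proof.
move=> E0; have iQ := ideal_gen_ideal (fun g : S => exists i, g = 'X_i).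
apply: monomial_ideal_sub => // u Eu.
have [i ui] : exists i, u i != 0%N.
  apply: contrapT => /forallNP h; case/negP: E0; have -> // : 0%MM = u.
  by apply/mnmP => i; rewrite mnm0E; apply/esym/eqP/negPn/negP/h.
have le_iu : (U_(i) <= u)%MM by rewrite lep1mP.
rewrite -(submK le_iu) mpolyXD; apply: (idealM _ iQ).
by apply: ideal_gen_sub; exists i.
Qed.

End MonomialIdeals.

(** * Orders and initial ideals *)

Section BlockOrder.
Variables (K : fieldType) (d r : nat).
Implicit Types (u v m : 'X_{1..3 * d}) (j : 'I_d).

(** In the block [j], [y_j^2] is heavier than [x_j z_j] exactly if [j < r]. *)
Definition block_weight u j : nat :=
  if (j < r)%N then (u (xi j) + 2 * u (yi j) + u (zi j))%N
  else (2 * u (xi j) + u (yi j) + 2 * u (zi j))%N.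

Definition weight u : nat := (\sum_j block_weight u j)%N.

Definition block_order : rel 'X_{1..3 * d} := fun u v =>
  (weight u < weight v)%N || ((weight u == weight v) && (u < v)%O).

Lemma weightD u v : weight (u + v)%MM = (weight u + weight v)%N.
Proof.
rewrite /weight -big_split; apply: eq_bigr => j _ /=.
rewrite /block_weight !mnmDE; case: ifP => _; lia.
Qed.

Lemma block_order_weight u v : block_order u v -> (weight u <= weight v)%N.
Proof. by case/orP => [/ltnW|/andP[/eqP->]]. Qed.

Theorem block_order_monomial_order : monomial_order block_order.
Proof.
split=> [u|v u w|u v ne_uv|u u0|u v w].
- by rewrite /block_order ltnn ltxx andbF.
- rewrite /block_order => /orP[lt_uv|/andP[/eqP-> lt_uv]] /orP[lt_vw|/andP[/eqP<- lt_vw]].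
  + by rewrite (ltn_trans lt_uv).
  + by rewrite lt_uv.
  + by rewrite lt_vw.
  + by rewrite eqxx (lt_trans lt_uv) ?orbT.
- rewrite /block_order; case: ltngtP => //= _.
  by case: ltgtP ne_uv => // ->; rewrite eqxx.
- rewrite /block_order; have -> : weight 0%MM = 0%N.
    by rewrite /weight big1 // => j _; rewrite /block_weight !mnm0E if_same.
  case: ltngtP => //= _; rewrite lt_neqAle le0m andbT eq_sym //.
- rewrite /block_order !weightD ltn_add2r eqn_add2r.
  by rewrite ltmc_add2l.
Qed.

(** The generators of the initial ideal in the block [j] are [x_j^2], [x_j y_j],
    [y_j^2] for [j < r] and [x_j^2], [x_j y_j], [x_j z_j], [y_j^3] otherwise. *)
Definition nonstandard_at u j := (2 < wt u j)%N || ((wt u j == 2) &&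
  (if (j < r)%N then 0 < u (yi j) else (0 < u (xi j)) && (0 < u (zi j))))%N.

Definition nonstandard u := [exists j, nonstandard_at u j].

Lemma nonstandard_up : upward_closed nonstandard.
Proof.
move=> u v /existsP[j hj]; apply/existsP; exists j; move: hj.
rewrite /nonstandard_at wtD /wt !mnmDE; case: ifP => _; lia.
Qed.

(** In a block, [wt] below 3 and [dg] determine a monomial up to an exchange of
    [y_j^2] and [x_j z_j], and a standard monomial contains the lighter one. *)
Lemma standard_lightest u m : ~~ nonstandard m ->
  (forall j, wt u j = wt m j) -> (forall j, dg u j = dg m j) ->
  (weight u <= weight m)%N -> u = m.
Proof.
rewrite negb_exists => /forallP std wt_um dg_um le_um.
have block j : (block_weight m j <= block_weight u j)%N /\
    (block_weight m j = block_weight u j ->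
     [/\ u (xi j) = m (xi j), u (yi j) = m (yi j) & u (zi j) = m (zi j)]).
  have := std j; have := wt_um j; have := dg_um j.
  rewrite /nonstandard_at /block_weight /wt /dg.
  case: ifP => _ h1 h2 h3; split; try lia; move=> h4; split; lia.
have [le_mu eq_mu] := leqif_sum (fun j (_ : xpredT j) => leqif_eq (block j).1).
have /forallP eqb : [forall (j | xpredT j), block_weight m j == block_weight u j].
  by rewrite -eq_mu eqn_leq le_mu.
apply/mnmP => i; case: (block_indexP i) => j;
  by have [] := (block j).2 (eqP (eqb j)).
Qed.

Lemma nonstandard_wt u : ~~ nonstandard u -> forall j, (wt u j < 3)%N.
Proof.
rewrite negb_exists => /forallP std j; have := std j.
by rewrite /nonstandard_at; case: ltnP.
Qed.

Local Notation I := (block_ideal K d).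

(** If [m] were standard, then the coefficient of [f] at [m] would be the only
    contribution to a coefficient of a coordinate of [f], which vanishes. *)
Lemma initial_nonstandard f m : f \in I -> is_initial_monomial block_order f m ->
  nonstandard m.
Proof.
move=> /block_idealP If [mf max_m]; apply: contraT => std.
have lt_wt := nonstandard_wt std.
pose w : {ffun 'I_d -> 'I_3} := [ffun j => inord (wt m j)].
have wE j : w j = wt m j :> nat by rewrite ffunE inordK.
have hw : has_wt w m by apply/forallP => j; rewrite wE.
have := congr1 (mcoeff (residue w m)) (If w); rewrite mcoeff0.
rewrite /coord /mpoly_linear raddf_sum /= (bigD1_seq m mf (msupp_uniq f)) /=.
rewrite mcoeffZ hw mcoeffX eqxx mulr1.
rewrite big_seq_cond big1 ?addr0 => [/eqP|u /andP[uf ne_um]].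
  by rewrite mcoeff_eq0 mf.
rewrite mcoeffZ; case: (boolP (has_wt w u)) => [/forallP wu|_]; last first.
  by rewrite mcoeff0 mulr0.
rewrite mcoeffX; case: eqP => [/mnmP eqr|_]; last by rewrite mulr0.
case/eqP: (ne_um); apply: standard_lightest => // [j|j|].
- by rewrite -wE; apply/eqP.
- have := eqr j; rewrite !mnmE wE.
  have := wt_dg u j; have := wt_dg m j; have /eqP := wu j; rewrite wE; lia.
- exact: block_order_weight (max_m _ uf ne_um).
Qed.

Lemma binomial_mem u v : (forall j, wt u j = wt v j) -> (forall j, dg u j = dg v j) ->
  'X_[u] - 'X_[v] \in I.
Proof.
move=> wt_uv dg_uv; apply/block_idealP => w.
rewrite coordD -scaleN1r coordZ scaleN1r !coordX.
have -> : has_wt w u = has_wt w v by apply: eq_forallb => j; rewrite wt_uv.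
have -> : residue w u = residue w v by apply/mnmP => j; rewrite !mnmE dg_uv.
by rewrite subrr.
Qed.

Lemma binomial_initial u v : 'X_[u] - 'X_[v] \in I -> block_order v u ->
  initial_ideal block_order I 'X_[u].
Proof.
move=> Iuv lt_vu; have [irr _ _ _ _] := block_order_monomial_order.
have ne_vu : v == u = false by apply/eqP => e; move: lt_vu; rewrite e irr.
have u1 : ('X_[u] - 'X_[v] : {mpoly K[3 * d]})@_u = 1.
  by rewrite mcoeffB !mcoeffX eqxx ne_vu subr0.
apply: ideal_gen_sub; exists ('X_[u] - 'X_[v]), u; split=> //.
  by apply/eqP => e; move: u1; rewrite e mcoeff0 => /eqP; rewrite eq_sym oner_eq0.
split; first by rewrite mcoeff_msupp u1 oner_eq0.
move=> t /msuppB_le; rewrite mem_cat !msuppX !inE => /orP[/eqP->|/eqP->] //.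
by rewrite eqxx.
Qed.

(** Such a monomial lies in the ideal, or else exchanging [y_j^2] and [x_j z_j] gives a
    smaller monomial congruent to it. *)
Lemma nonstandard_initial u : nonstandard u -> initial_ideal block_order I 'X_[u].
Proof.
move=> /existsP[j /orP[wt3|/andP[/eqP wt2 hj]]].
  apply: ideal_gen_sub; exists 'X_[u], u; split=> //.
  - apply/block_idealP => w; rewrite coordX ifF //; apply/negP => /forallP/(_ j)/eqP e.
    by move: wt3; rewrite e ltnNge -ltnS ltn_ord.
  - by rewrite -msupp_eq0 msuppX.
  - by split=> [|t]; rewrite msuppX inE // => /eqP->; rewrite eqxx.
pose yy : 'X_{1..3 * d} := (U_(yi j) + U_(yi j))%MM.
pose xz : 'X_{1..3 * d} := (U_(xi j) + U_(zi j))%MM.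
have wt_yyxz j' : wt yy j' = wt xz j'.
  by rewrite !wtD !wty wtx wtz; lia.
have dg_yyxz j' : dg yy j' = dg xz j'.
  by rewrite !dgD !dgy dgx dgz.
have bw j' : block_weight yy j' = if j' == j then if (j < r)%N then 4 else 2 else 0%N.
  rewrite [j' == j]eq_sym /block_weight !mnmDE !mnm1E !block_eqE.
  by case: eqP => [->|] /=; case: ifP.
have bw' j' : block_weight xz j' = if j' == j then if (j < r)%N then 2 else 4 else 0%N.
  rewrite [j' == j]eq_sym /block_weight !mnmDE !mnm1E !block_eqE.
  by case: eqP => [->|] /=; case: ifP.
have wyy : weight yy = if (j < r)%N then 4 else 2.
  by rewrite /weight (eq_bigr _ (fun j' _ => bw j')) -big_mkcond big_pred1_eq.
have wxz : weight xz = if (j < r)%N then 2 else 4.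
  by rewrite /weight (eq_bigr _ (fun j' _ => bw' j')) -big_mkcond big_pred1_eq.
pose heavy := if (j < r)%N then yy else xz.
pose light := if (j < r)%N then xz else yy.
have le_hu : (heavy <= u)%MM.
  apply/mnm_lepP => i; rewrite /heavy; move: hj wt2; rewrite /wt; case: ifP => _;
  rewrite mnmDE !mnm1E; case: (block_indexP i) => j'; rewrite !block_eqE;
  by case: (j =P j') => [<-|_] /=; lia.
rewrite -(submK le_hu); apply: (@binomial_initial _ ((u - heavy) + light)%MM).
  apply: binomial_mem => j'; rewrite /heavy /light; case: ifP => _.
  - by rewrite [LHS]wtD [RHS]wtD wt_yyxz.
  - by rewrite [LHS]wtD [RHS]wtD wt_yyxz.
  - by rewrite [LHS]dgD [RHS]dgD dg_yyxz.
  - by rewrite [LHS]dgD [RHS]dgD dg_yyxz.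
rewrite /block_order !weightD ltn_add2l /heavy /light.
by case: ifP wyy wxz => _ -> ->.
Qed.

Theorem initial_idealE : initial_ideal block_order I = monomial_ideal nonstandard.
Proof.
apply: ideal_ext => f; split.
  apply: ideal_gen_min; first exact/monomial_ideal_ideal/nonstandard_up.
  move=> g [h [m [Ih _ ini ->]]]; apply/monomial_idealX.
  exact: initial_nonstandard ini.
apply: monomial_ideal_sub; first exact: ideal_gen_ideal.
exact: nonstandard_initial.
Qed.

(** The monomials of the initial ideal enlarged by the [z_j] with [j] in [T]. *)
Let cut (T : seq 'I_d) : pred 'X_{1..3 * d} :=
  fun u => nonstandard u || has (fun j => 0 < u (zi j))%N T.

Let cut_up T : upward_closed (cut T).
Proof.
move=> u v /orP[nu|/hasP[j jT uj]]; apply/orP; first by left; apply: nonstandard_up.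
by right; apply/hasP; exists j => //; rewrite mnmDE; lia.
Qed.

Let zvar j : {mpoly K[3 * d]} := 'X_(zi j).

Let cut_regular T l : uniq l -> (forall j, j \in l -> (j < r)%N /\ j \notin T) ->
  regular_by nonzerodivisor (monomial_ideal (cut T)) (map zvar l) /\
  adjoin (monomial_ideal (cut T)) (map zvar l) = monomial_ideal (cut (catrev l T)).
Proof.
elim: l T => [|j l IH] T /=.
  by move=> _ _; rewrite adjoin_nil //; apply/monomial_ideal_ideal/cut_up.
move=> /andP[jl uniq_l] hl.
have cutS : adjoin (monomial_ideal (cut T)) [:: zvar j] = monomial_ideal (cut (j :: T)).
  apply: monomial_ideal_adjoin; [exact: cut_up | exact: cut_up |] => u.
  by rewrite /cut /= orbCA orbC.
rewrite (adjoin_cons _ (zvar j) (map zvar l)) cutS.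
have [lt_jr jT] := hl j (mem_head _ _).
have [|reg eqJ] := IH (j :: T) uniq_l.
  move=> j' j'l; have [|lt_j'r j'T] := hl j'; first by rewrite inE j'l orbT.
  by rewrite inE negb_or j'T andbT; split=> //; apply: contraNneq jl => <-.
do 2 split=> //; apply: monomial_nonzerodivisor => u /orP[/existsP[j' nj']|].
  apply/orP; left; apply/existsP; exists j'; move: nj'.
  rewrite /nonstandard_at /wt !mnmDE !mnm1E !block_eqE.
  by case: (j =P j') => [<-|_]; rewrite ?lt_jr !add0n.
move=> /hasP[j' j'T]; rewrite mnmDE mnm1E block_eqE => uj'.
apply/orP; right; apply/hasP; exists j' => //; move: uj'.
by case: eqP => // e; move: jT; rewrite e j'T.
Qed.

(** For [j < r] no generator of the initial ideal involves [z_j]; for the other [j]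
    the initial ideal contains [x_j z_j]. *)
Theorem initial_ideal_depth : (r <= d)%N ->
  has_depth (graded_maximal_ideal K (3 * d)) (initial_ideal block_order I) r.
Proof.
move=> le_rd; rewrite initial_idealE.
pose l := map (widen_ord le_rd) (enum 'I_r).
have uniq_l : uniq l.
  by rewrite map_inj_uniq ?enum_uniq // => i j /(congr1 val) /= /val_inj.
have mem_l j : (j \in l) = (j < r)%N.
  apply/mapP/idP => [[i _ ->]|lt_jr]; first exact: (ltn_ord i).
  by exists (Ordinal lt_jr); rewrite ?mem_enum //; apply: val_inj.
have [|reg eqJ] := @cut_regular [::] l uniq_l.
  by move=> j; rewrite mem_l.
have cut0 : cut [::] = nonstandard.
  by apply: funext => u; rewrite /cut orbF.
rewrite cut0 in reg eqJ.
have iQ : is_ideal (graded_maximal_ideal K (3 * d)) by apply: ideal_gen_ideal.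
have <- : size (map zvar l) = r.
  by rewrite size_map size_map size_enum_ord.
apply: has_depthI => //.
- exact: noetherian_mpoly.
- exact: graded_maximal_ideal_proper.
- exact/monomial_ideal_ideal/nonstandard_up.
- apply: monomial_ideal_graded_maximal.
  rewrite negb_exists; apply/forallP => j.
  by rewrite /nonstandard_at /wt !mnm0E.
- by move=> x /mapP[j _ ->]; apply: ideal_gen_sub; exists (zi j).
move=> x Qx; apply: socle_no_nonzerodivisor Qx; rewrite eqJ.
(* The socle element: the product of all [x_j]. *)
pose u : 'X_{1..3 * d} := block_monomial (fun k j => (k == inord 0) : nat).
have ux j : u (xi j) = 1%N by rewrite block_monomialE eqxx.
have uy j : u (yi j) = 0%N by rewrite block_monomialE -val_eqE /= !inordK.
have uz j : u (zi j) = 0%N by rewrite block_monomialE -val_eqE /= !inordK.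
have iE := @monomial_ideal_ideal K _ _ (@cut_up (catrev l [::])).
exists 'X_[u]; split.
  move=> /monomial_idealX /orP[/existsP[j]|/hasP[j _]]; last by rewrite uz.
  by rewrite /nonstandard_at /wt ux uy uz; case: ifP.
apply: ideal_gen_min.
  split=> [|f g hf hg|a f hf]; first by rewrite mul0r; apply: (ideal0 iE).
    by rewrite mulrDl; apply: (idealD iE).
  by rewrite -mulrA; apply: (idealM _ iE).
move=> _ [i ->]; rewrite -mpolyXD; apply/monomial_idealX.
case: (block_indexP i) => j; apply/orP.
- left; apply/existsP; exists j.
  by rewrite /nonstandard_at wtD wtx eqxx /wt ux.
- left; apply/existsP; exists j.
  by rewrite /nonstandard_at wtD wty eqxx /wt ux.
- have [lt_jr|le_rj] := ltnP j r.
    right; apply/hasP; exists j; last by rewrite mnmDE mnm1E eqxx.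
    by rewrite catrevE mem_cat mem_rev mem_l lt_jr.
  left; apply/existsP; exists j.
  rewrite /nonstandard_at wtD wtz /wt !mnmDE !mnm1E !block_eqE ux uy uz.
  have -> : (j < r)%N = false by rewrite ltnNge le_rj.
  by rewrite eqxx.
Qed.

End BlockOrder.

Theorem theorem2p1 (K : fieldType) (d : nat) (hd : (0 < d)%N) :
  exists I : idealr {mpoly K[3 * d]},
    [/\ homogeneous_ideal I,
        cohen_macaulay {ideal_quot I},
        has_krull_dim {ideal_quot I} d &
        forall r : nat, (r <= d)%N ->
          exists lt : rel 'X_{1..3 * d},
            monomial_order lt /\
            has_depth (graded_maximal_ideal K (3 * d)) (initial_ideal lt I) r].
Proof.
exists (block_ideal K d); split.
- exact: block_ideal_homogeneous.
- exact: block_ideal_cohen_macaulay.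
- exact: block_ideal_krull_dim.
move=> r le_rd; exists (@block_order d r); split.
  exact: block_order_monomial_order.
exact: initial_ideal_depth.
Qed.
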